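(* Let $(q_0,\rho_0)\in C(\Omega;\mathbb R^{d+1})$ with $\rho_0>0$. Let $(q,\rho)$ be a strong solution on $[0,T]$ (in the sense of the context) of the compressible barotropic Euler system $\partial_t q+\operatorname{div}\big(\frac{q\otimes q}{\rho}\big)+\nabla(P(\rho))=0$, $\partial_t\rho+\operatorname{div}q=0$, $q(0)=q_0$, $\rho(0)=\rho_0$, with total entropy $$K(t)=\int_\Omega\Big(\frac{|q(t,x)|^2}{2\rho(t,x)}+U(\rho(t,x))\Big)dx,$$ and let $(\tilde q,\tilde\rho,M)$ be a subsolution on $[0,T]$ (with the same initial data) with total entropy $\tilde K(t)=\frac12\int_\Omega\operatorname{Tr}M(t,x)\,dx$. Then, for any $0\le t_0<t_1\le T$, it cannot simultaneously be that $\tilde K(t)\le K(t)$ for all $t\in[0,t_0]$ and $\tilde K(t)<K(t)$ for all $t\in(t_0,t_1)$. In particular, it is impossible that $\tilde K(t)<K(t)$ for all $t\in(0,\epsilon)$ for some $\epsilon>0$.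
   Context: Notation. $\Omega=\mathbb T^d$ is the periodic box with Lebesgue measure $dx$; $T>0$; $\mathcal L=dx\,dt$ on $[0,T]\times\Omega$. $\mathbb R^{N\times N}_s$, $\mathbb R^{N\times N}_+$ are the symmetric and the positive semidefinite matrices; $A\ge B$ iff $A-B\in\mathbb R^{N\times N}_+$; $A:B$ is the Frobenius scalar product; $I$ is the identity matrix; $e_i$ is the standard basis. $\mathcal M(Q;V)$ denotes finite $V$-valued Radon measures on $Q$; a symmetric-matrix-valued measure is $\ge0$ if its values are positive semidefinite. $\langle f,\mu\rangle=\int_{[0,T]\times\Omega}f\cdot d\mu$. Functions of $x$ only are also regarded as time-independent functions of $(t,x)$. Assumptions on the pressure. $P:[0,\infty)\to\mathbb R$ is continuous and convex, $P(0)=0$, and $P(y)=U'(y)y-U(y)+U(0)$ for $y>0$, where $U:[0,\infty)\to\mathbb R$ is continuous and convex, smooth with $U''>0$ on $(0,\infty)$. The function $2U(y)-dP(y)$ is convex. By adding an affine function to $U$ (this does not change $P$), $U$ is normalized so that $2U(y)-dP(y)-y\ge0$ for $y\ge0$. Abstract form. $n=N=d+1$, $v=(q,\rho)\in\mathbb R^d\times\mathbb R$, $v_0=(q_0,\rho_0)$, $\operatorname{dom}\mathbf F=\{\rho>0\}\cup\{(0,0)\}$, $\mathcal O=\{\rho>0\}$, $$\mathbf F(v)=\frac{v\otimes v}{\rho}+\sum_{i=1}^dP(\rho)e_i\otimes e_i+[2U(\rho)-dP(\rho)-\rho]e_N\otimes e_N\ (\rho>0),\qquad\mathbf F(0,0)=2U(0)e_N\otimes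 e_N,$$ $$L\begin{pmatrix}\Xi&\eta\\ \eta^\top&\kappa\end{pmatrix}=\begin{pmatrix}-\operatorname{div}\Xi\\-\operatorname{div}\eta\end{pmatrix},\qquad L^*\begin{pmatrix}\xi\\ \theta\end{pmatrix}=\frac12\begin{pmatrix}\nabla\xi+(\nabla\xi)^\top&\nabla\theta\\(\nabla\theta)^\top&0\end{pmatrix}.$$ The entropy is $\mathbf K(q,\rho)=\frac12\operatorname{Tr}\mathbf F(q,\rho)=\frac{|q|^2}{2\rho}+U(\rho)$ for $\rho>0$, and for $v\in\mathcal O$, $v^{\#}=\nabla\mathbf K(v)=\big(\frac q\rho,-\frac{|q|^2}{2\rho^2}+U'(\rho)\big)$. $\partial_l\mathbf F$ is the partial derivative in the $l$-th component of $v$. There is no linear constraint. Weight. $\mathfrak h:[0,T]\to\mathbb R_+$ is a fixed smooth function bounded away from $0$ and $\infty$, $\mathfrak H(t)=\int_t^T\mathfrak h(s)\,ds$. (The notion of strong solution does not depend on the choice of $\mathfrak h$.) Constraint (LC) on pairs $(E,B)\in\mathcal M([0,T]\times\Omega;\mathbb R^n)\times\mathcal M([0,T]\times\Omega;\mathbb R^{N\times N}_s)$: $\langle\partial_t\Psi,B\rangle+\langle L\Psi,E\rangle=0$ for all smooth $\Psi:[0,T]\times\Omega\to\mathbb R^{N\times N}_s$ with $\Psi(0)=0$. Weak solution. $v=(q,\rho)\in C([0,T]\times\Omega;\mathbb R^n)$ with values in $\operatorname{dom}\mathbf F$ and $\mathbf F(v)$ continuous, such that $\langle v-v_0,E\rangle+\langle\mathbf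 F(v),B\rangle=0$ for all $(E,B)$ satisfying (LC). Subsolution. $(\tilde v,M)$ with $\tilde v=(\tilde q,\tilde\rho)\in C([0,T]\times\Omega;\mathbb R^n)$, $M\in C([0,T]\times\Omega;\mathbb R^{N\times N}_+)$, $\tilde v\in\operatorname{dom}\mathbf F$ and $\mathbf F(\tilde v)\le M$ pointwise, such that $\langle\tilde v-v_0,E\rangle+\langle M,B\rangle=0$ for all $(E,B)$ satisfying (LC). Strong solution. A weak solution $v\in C([0,T]\times\Omega;\mathcal O)$ such that: (i) there exist finite measures, denoted $\partial_t(\mathfrak Hv^{\#}\mathcal L)\in\mathcal M([0,T]\times\Omega;\mathbb R^n)$ and $\mathfrak HL^*(v^{\#}\mathcal L)\in\mathcal M([0,T]\times\Omega;\mathbb R^{N\times N}_s)$, with $\langle\phi,\partial_t(\mathfrak Hv^{\#}\mathcal L)\rangle=-\langle\partial_t\phi,\mathfrak Hv^{\#}\mathcal L\rangle$ and $\langle\Phi,\mathfrak HL^*(v^{\#}\mathcal L)\rangle=\langle L\Phi,\mathfrak Hv^{\#}\mathcal L\rangle$ for all smooth $\phi,\Phi$ on $[0,T]\times\Omega$ (with values in $\mathbb R^n$, $\mathbb R^{N\times N}_s$) with $\phi(0)=0$; (ii) $cI\mathcal L+\mathfrak HL^*(v^{\#}\mathcal L)\ge0$ for some constant $c\ge0$; (iii) $\int_\Omega\mathbf K(v(t,x))\,dx=\int_\Omega\mathbf K(v_0)\,dx$ for all $t\in[0,T]$; (iv) for $l=1,\dots,n$, as finite Radon measures, $\mathfrak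 h(v^{\#}\mathcal L)_l+\partial_t(\mathfrak Hv^{\#}\mathcal L)_l+\mathfrak HL^*(v^{\#}\mathcal L):\partial_l\mathbf F(v)=0$. *)

(* Defs.v *)
From HB Require Import structures.
From mathcomp Require Import all_boot all_order all_algebra.
From mathcomp Require Import all_classical all_reals all_analysis.

Set Implicit Arguments.
Unset Strict Implicit.
Unset Printing Implicit Defensive.

Import Order.TTheory GRing.Theory Num.Theory.
Import numFieldNormedType.Exports.

Local Open Scope classical_set_scope.
Local Open Scope ring_scope.

(* The sigma-algebra generated by the entries.  Since R is second countable, it
   is the Borel sigma-algebra of the matrix topology, and the product
   sigma-algebra of R * 'rV[R]_d is the Borel one as well. *)
Section measurable_matrix.
Context {R : realType} (m n : nat).

Let entries : set_system 'M[R]_(m, n) :=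
  [set A | exists i j, exists2 B : set R, measurable B &
    A = (fun M : 'M[R]_(m, n) => M i j) @^-1` B].

Let mx_set0 : <<s entries >> set0.
Proof. exact: sigma_algebra0. Qed.

Let mx_setC A : <<s entries >> A -> <<s entries >> (~` A).
Proof. exact: sigma_algebraC. Qed.

Let mx_bigcup (F : (set 'M[R]_(m, n))^nat) :
  (forall i, <<s entries >> (F i)) -> <<s entries >> (\bigcup_i (F i)).
Proof. exact: sigma_algebra_bigcup. Qed.

HB.instance Definition _ := @isMeasurable.Build default_measure_display
  'M[R]_(m, n) <<s entries >> mx_set0 mx_setC mx_bigcup.

Lemma measurable_entry i j :
  measurable_fun [set: 'M[R]_(m, n)] (fun M : 'M[R]_(m, n) => M i j).
Proof.
move=> _ B mB; rewrite setTI; apply: sub_sigma_algebra.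
by exists i, j; exists B.
Qed.

Lemma measurable_fun_mx d (X : measurableType d) (f : X -> 'M[R]_(m, n)) :
  (forall i j, measurable_fun [set: X] (fun x => f x i j)) ->
  measurable_fun [set: X] f.
Proof.
move=> mf; apply: (@measurability _ _ _ _ _ _ entries) => //.
move=> _ [_ [i [j [B mB ->]]] <-]; have := mf i j measurableT B mB.
by rewrite !setTI.
Qed.

End measurable_matrix.

(* Lebesgue measure on R^d, by recursion on d through R^(1+d) = R * R^d. *)
Section lebesgue_measure_rV.
Context {R : realType}.

Definition rV_cons d (p : R * 'rV[R]_d) : 'rV[R]_d.+1 :=
  \row_i oapp (p.2 0) p.1 (unlift ord0 i).

Definition rV_uncons d (x : 'rV[R]_d.+1) : R * 'rV[R]_d :=
  (x 0 ord0, \row_i x 0 (lift ord0 i)).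

Lemma rV_consK d : cancel (@rV_cons d) (@rV_uncons d).
Proof.
move=> [a x]; congr pair; first by rewrite mxE unlift_none.
by apply/rowP => i; rewrite !mxE liftK.
Qed.

Lemma measurable_rV_cons d : measurable_fun [set: R * 'rV[R]_d] (@rV_cons d).
Proof.
apply: measurable_fun_mx => i j.
under eq_fun do rewrite mxE.
case: unliftP => [k|] _ /=; last exact: measurable_fst.
exact: (measurableT_comp (measurable_entry 0 k)).
Qed.

Lemma measurable_rV_uncons d :
  measurable_fun [set: 'rV[R]_d.+1] (@rV_uncons d).
Proof.
apply/measurable_fun_pairP; split; first exact: measurable_entry.
apply: measurable_fun_mx => i j.
by under eq_fun do rewrite mxE; exact: measurable_entry.
Qed.

Section rV_step.
Context d (mu : {sigma_finite_measure set 'rV[R]_d -> \bar R}).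

Definition lebesgue_rV_step : set 'rV[R]_d.+1 -> \bar R :=
  pushforward ((@lebesgue_measure R) \x mu)%E (@rV_cons d).

Let step0 : lebesgue_rV_step set0 = 0%E.
Proof. by rewrite /lebesgue_rV_step /pushforward preimage_set0 measure0. Qed.

Let step_ge0 A : (0 <= lebesgue_rV_step A)%E.
Proof. by rewrite /lebesgue_rV_step /pushforward measure_ge0. Qed.

Let step_sigma_additive : semi_sigma_additive lebesgue_rV_step.
Proof.
move=> F mF tF mUF; rewrite /lebesgue_rV_step /pushforward preimage_bigcup.
have mp A : measurable A -> measurable (@rV_cons d @^-1` A).
  by move=> mA; rewrite -[X in measurable X]setTI; exact: measurable_rV_cons.
apply: measure_semi_sigma_additive => [n||]; first exact: mp.
- apply/trivIsetP => i j _ _ ij; rewrite -preimage_setI.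
  by move/trivIsetP : tF => /(_ _ _ _ _ ij) ->//; rewrite preimage_set0.
- by rewrite -preimage_bigcup; exact: mp.
Qed.

HB.instance Definition _ := isMeasure.Build _ _ _ lebesgue_rV_step
  step0 step_ge0 step_sigma_additive.

Let step_sigma_finite : sigma_finite setT lebesgue_rV_step.
Proof.
have /sigma_finiteP[F [FT ndF Foo]] := sigma_finiteT (@lebesgue_measure R).
have /sigma_finiteP[G [GT ndG Goo]] := sigma_finiteT mu.
exists (fun n => @rV_uncons d @^-1` (F n `*` G n)).
  rewrite -preimage_bigcup -[LHS](preimage_setT (@rV_uncons d)).
  congr (_ @^-1` _).
  apply/seteqP; split=> // -[a x] _.
  have [n _ Fa] : (\bigcup_n F n) a by rewrite -FT.
  have [k _ Gx] : (\bigcup_n G n) x by rewrite -GT.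
  exists (maxn n k) => //; split.
  - by move: a Fa; exact/subsetPset/ndF/leq_maxl.
  - by move: x Gx; exact/subsetPset/ndG/leq_maxr.
move=> n; have [mF Fn] := Foo n; have [mG Gn] := Goo n.
have mFG := measurableX mF mG; split.
  by rewrite -[X in measurable X]setTI; exact: measurable_rV_uncons.
rewrite /lebesgue_rV_step /pushforward -comp_preimage.
rewrite (_ : @rV_uncons d \o @rV_cons d = id); last first.
  by apply/funext => x /=; rewrite rV_consK.
by rewrite preimage_id product_measure1E// lte_mul_pinfty// ge0_fin_numE.
Qed.

HB.instance Definition _ := Measure_isSigmaFinite.Build _ _ _ lebesgue_rV_step
  step_sigma_finite.

End rV_step.

Fixpoint lebesgue_rV d : {sigma_finite_measure set 'rV[R]_d -> \bar R} :=
  match d with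
  | 0%N => \d_(0 : 'rV[R]_0)
  | d'.+1 => lebesgue_rV_step (lebesgue_rV d')
  end.

End lebesgue_measure_rV.

(* Integral of f over D against a finite signed measure, through a Hahn
   decomposition (the result does not depend on the chosen one). *)
Section charge_integral.
Context d (X : measurableType d) {R : realType}.
Variable nu : {charge set X -> \bar R}.

Lemma hahn_decomposition_ex :
  exists PN : set X * set X, hahn_decomposition nu PN.1 PN.2.
Proof. by have [P [N nuPN]] := Hahn_decomposition nu; exists (P, N). Qed.

Let nuPN := projT2 (cid hahn_decomposition_ex).

Definition charge_integral (D : set X) (f : X -> R) : R :=
  \int[jordan_pos nuPN]_(x in D) f x - \int[jordan_neg nuPN]_(x in D) f x.

End charge_integral.

Section smooth_functions.
Context {R : realType} {V W : normedModType R}.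

Fixpoint cont_diff (k : nat) (f : V -> W) : Prop :=
  continuous f /\
  if k is k'.+1 then
    forall w, (forall x, derivable f x w) /\ cont_diff k' ('D_w f)
  else True.

Definition smooth (f : V -> W) : Prop := forall k, cont_diff k f.

End smooth_functions.

Definition psd {R : realType} {n : nat} (A : 'M[R]_n) : Prop :=
  A^T = A /\ forall x : 'rV[R]_n, 0 <= (x *m A *m x^T) 0 0.

(* Functions on the torus T^d = R^d / Z^d are the functions on R^d with period 1
   in every coordinate; measures on the torus are measures on the fundamental
   domain [0, 1)^d. *)
Section torus.
Context {R : realType} (d : nat).

Definition unit_cell : set 'rV[R]_d := [set x | forall i, 0 <= x 0 i < 1].

Definition periodic {W : Type} (f : 'rV[R]_d -> W) : Prop :=
  forall x i, f (x + delta_mx 0 i) = f x.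

Definition torus_continuous {W : topologicalType} (f : 'rV[R]_d -> W) : Prop :=
  periodic f /\ continuous f.

Definition torus_integral (f : 'rV[R]_d -> R) : R :=
  \int[lebesgue_rV d]_(x in unit_cell) f x.

End torus.

(* Functions on [0, T] x T^d are functions on R x R^d, periodic in space, of
   which only the values at times in [0, T] matter.  A finite (signed) Radon
   measure on [0, T] x T^d is a charge on R x R^d, of which only the values on
   the measurable subsets of [0, T] x [0, 1)^d matter. *)
Section spacetime.
Context {R : realType} (d : nat) (T : R).
Local Notation ST := (R * 'rV[R]_d)%type.

(* Same carrier as ST, seen as a measurable type. *)
Definition measurable_spacetime := (measurableTypeR R * 'rV[R]_d)%type.
HB.instance Definition _ := Measurable.on measurable_spacetime.

Definition radon := {charge set measurable_spacetime -> \bar R}.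

Definition slab : set ST := `[0, T]%classic `*` setT.

Definition cell : set ST := `[0, T]%classic `*` @unit_cell R d.

Definition continuous_on_slab {W : topologicalType} (f : ST -> W) : Prop :=
  (forall t, 0 <= t <= T -> periodic (fun x => f (t, x))) /\
  {within slab, continuous f}.

(* Smooth functions on [0, T] x T^d, up to the boundary, are the restrictions of
   smooth functions on R x T^d. *)
Definition smooth_on_slab {W : normedModType R} (f : ST -> W) : Prop :=
  (forall t, periodic (fun x => f (t, x))) /\ smooth f.

Definition Dt {W : normedModType R} (f : ST -> W) : ST -> W :=
  'D_((1, 0) : ST) f.

Definition Dx {W : normedModType R} (j : 'I_d) (f : ST -> W) : ST -> W :=
  'D_((0, delta_mx 0 j) : ST) f.

Definition leb_spacetime : set measurable_spacetime -> \bar R :=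
  (lebesgue_measure \x lebesgue_rV d)%E.
HB.instance Definition _ := Measure.on leb_spacetime.

Definition pairing_v n (f : ST -> 'rV[R]_n) (E : 'I_n -> radon) : R :=
  \sum_i charge_integral (E i) cell (fun p => f p 0 i).

Definition pairing_m n (F : ST -> 'M[R]_n) (B : 'I_n -> 'I_n -> radon) : R :=
  \sum_i \sum_j charge_integral (B i j) cell (fun p => F p i j).

(* <f, g dxdt> *)
Definition pairing_L n (f g : ST -> 'rV[R]_n) : R :=
  \int[leb_spacetime]_(p in cell) (\sum_i f p 0 i * g p 0 i).

Definition sym_valued n (B : 'I_n -> 'I_n -> radon) : Prop :=
  forall (A : set measurable_spacetime) i j,
    measurable A -> A `<=` cell -> B i j A = B j i A.

End spacetime.

Arguments leb_spacetime {R} d.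

Record pressure_law {R : realType} (d : nat) (P U : R -> R) : Prop := {
  pressure_continuous : {within `[0, +oo[, continuous P};
  pressure_convex : convex_function (`[0, +oo[%classic : set R) P;
  pressure_0 : P 0 = 0;
  pressureE : forall y, 0 < y -> P y = derive1 U y * y - U y + U 0;
  energy_continuous : {within `[0, +oo[, continuous U};
  energy_convex : convex_function (`[0, +oo[%classic : set R) U;
  energy_smooth : forall k y, 0 < y -> derivable (derive1n k U) y 1;
  energy_derive2_gt0 : forall y, 0 < y -> 0 < derive1n 2 U y;
  energy_pressure_convex :
    convex_function (`[0, +oo[%classic : set R) (fun y => 2 * U y - d%:R * P y);
  energy_normalized : forall y, 0 <= y -> 0 <= 2 * U y - d%:R * P y - y
}.

(* The state v = (q, rho) is a row vector of size d + 1. *)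
Section euler.
Context {R : realType} (d : nat) (P U : R -> R).
Local Notation N := (d + 1)%N.
Local Notation ST := (R * 'rV[R]_d)%type.
Local Notation radon := (@radon R d).

Definition state (q : 'rV[R]_d) (rho : R) : 'rV[R]_N := row_mx q rho%:M.

Definition density (v : 'rV[R]_N) : R := rsubmx v 0 0.

Definition dom_flux : set 'rV[R]_N := [set v | 0 < density v \/ v = 0].

(* Meaningful on dom_flux only. *)
Definition flux (v : 'rV[R]_N) : 'M[R]_N :=
  let rho := density v in
  if 0 < rho then
    rho^-1 *: (v^T *m v) +
    block_mx (P rho)%:M 0 0 (2 * U rho - d%:R * P rho - rho)%:M
  else block_mx 0 0 0 (2 * U 0)%:M.

Definition entropy (v : 'rV[R]_N) : R := 2^-1 * \tr (flux v).

Definition entropy_grad (v : 'rV[R]_N) : 'rV[R]_N :=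
  \row_l 'D_(delta_mx 0 l) entropy v.

Definition Dflux (l : 'I_N) (v : 'rV[R]_N) : 'M[R]_N :=
  'D_(delta_mx 0 l) flux v.

(* L (Xi, eta; eta^T, kappa) = (- div Xi, - div eta) in block form, that is, row
   i is minus the divergence of the first d entries of row i of Psi. *)
Definition div_op (Psi : ST -> 'M[R]_N) (p : ST) : 'rV[R]_N :=
  \row_i - \sum_(j < d) Dx j Psi p i (lshift 1 j).

Definition lin_constraint (T : R) (E : 'I_N -> radon)
    (B : 'I_N -> 'I_N -> radon) : Prop :=
  forall Psi : ST -> 'M[R]_N, smooth_on_slab Psi ->
    (forall p, (Psi p)^T = Psi p) -> (forall x, Psi (0, x) = 0) ->
    pairing_m T (Dt Psi) B + pairing_v T (div_op Psi) E = 0.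

Record weak_solution (T : R) (v0 : 'rV[R]_d -> 'rV[R]_N)
    (v : ST -> 'rV[R]_N) : Prop := {
  weak_continuous : continuous_on_slab T v;
  weak_dom : forall t x, 0 <= t <= T -> dom_flux (v (t, x));
  weak_F_continuous : continuous_on_slab T (flux \o v);
  weak_eq : forall (E : 'I_N -> radon) (B : 'I_N -> 'I_N -> radon),
    sym_valued T B -> lin_constraint T E B ->
    pairing_v T (fun p => v p - v0 p.2) E + pairing_m T (flux \o v) B = 0
}.

Record subsolution (T : R) (v0 : 'rV[R]_d -> 'rV[R]_N)
    (v : ST -> 'rV[R]_N) (M : ST -> 'M[R]_N) : Prop := {
  sub_continuous : continuous_on_slab T v;
  sub_M_continuous : continuous_on_slab T M;
  sub_M_psd : forall t x, 0 <= t <= T -> psd (M (t, x));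
  sub_dom : forall t x, 0 <= t <= T -> dom_flux (v (t, x));
  sub_le : forall t x, 0 <= t <= T -> psd (M (t, x) - flux (v (t, x)));
  sub_eq : forall (E : 'I_N -> radon) (B : 'I_N -> 'I_N -> radon),
    sym_valued T B -> lin_constraint T E B ->
    pairing_v T (fun p => v p - v0 p.2) E + pairing_m T M B = 0
}.

Record weight (T : R) (h : R -> R) : Prop := {
  weight_smooth : smooth h;
  weight_bounds : exists a b, 0 < a /\ forall t, 0 <= t <= T -> a <= h t <= b
}.

Definition weight_tail (T : R) (h : R -> R) (t : R) : R :=
  \int[lebesgue_measure]_(s in `[t, T]) h s.

(* mu and nu are the measures d_t(H v^# dxdt) and H L^*(v^# dxdt), where
   v^# = entropy_grad v, L^* is the formal adjoint of div_op and
   H = weight_tail T h.  The first condition on them does not determine mu on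
   the time slice t = 0, the last one does. *)
Record strong_solution (T : R) (h : R -> R) (v0 : 'rV[R]_d -> 'rV[R]_N)
    (v : ST -> 'rV[R]_N) : Prop := {
  strong_weak : weak_solution T v0 v;
  strong_density : forall t x, 0 <= t <= T -> 0 < density (v (t, x));
  strong_energy : forall t, 0 <= t <= T ->
    torus_integral (fun x => entropy (v (t, x))) =
    torus_integral (fun x => entropy (v0 x));
  strong_measures : exists (mu : 'I_N -> radon) (nu : 'I_N -> 'I_N -> radon),
    let Hv := fun p : ST => weight_tail T h p.1 *: entropy_grad (v p) in
    [/\ sym_valued T nu,
        forall phi : ST -> 'rV[R]_N, smooth_on_slab phi ->
          (forall x, phi (0, x) = 0) ->
          pairing_v T phi mu = - pairing_L T (Dt phi) Hv,
        forall Phi : ST -> 'M[R]_N, smooth_on_slab Phi ->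
          (forall p, (Phi p)^T = Phi p) ->
          pairing_m T Phi nu = pairing_L T (div_op Phi) Hv,
        exists2 c : R, 0 <= c &
          forall A : set (@measurable_spacetime R d),
            measurable A -> A `<=` cell T ->
            psd (\matrix_(i, j) fine (nu i j A)
                 + (c * fine (leb_spacetime d A))%:M)
      & forall (l : 'I_N) (A : set (@measurable_spacetime R d)),
          measurable A -> A `<=` cell T ->
          \int[leb_spacetime d]_(p in A) (h p.1 * entropy_grad (v p) 0 l)
          + fine (mu l A)
          + \sum_i \sum_j charge_integral (nu i j) A
              (fun p => Dflux l (v p) i j) = 0]
}.

End euler.

(* Main.v *)
(* The strong solution [v] provides measures [mu = d_t(H v^#)] and
   [nu = H L^* v^#] such that, for every smooth [theta] of [t] only,
   [(theta' H v^# + theta mu, theta nu)] is admissible in the linear constraint.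
   Testing the weak formulation of [v] and the subsolution [(w, M)] with this
   pair and using condition (iv) gives
     [int (theta h - theta' H) W dt = <G, theta nu>],
   where [W = int v^# . (w - v) dx] and [G = M - F(v) - sum_l (w - v)_l d_l F(v)].
   The flux is Loewner convex, hence [G >= 0]; since [nu >= - c I] and
   [tr G / 2] integrates to [(Kt - K) - W >= 0], this yields
     [int ((theta h - theta' H - 2 c theta) W + 2 c theta (Kt - K)) dt >= 0].
   With [theta = exp(- lam t)] and [lam] large the coefficient of [W] is
   nonnegative away from [t = T], and [W <= Kt - K <= 0] on [(0, t1)]; the
   exponential decay of [theta] makes the contribution of later times
   negligible, which contradicts [Kt < K] on [(t0, t1)]. *)
Require Import Defs.
From HB Require Import structures.
From mathcomp Require Import all_boot all_order all_algebra.
From mathcomp Require Import all_classical all_reals all_analysis.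
From mathcomp Require Import measurable_realfun ring lra.

Set Implicit Arguments.
Unset Strict Implicit.
Unset Printing Implicit Defensive.

Import Order.TTheory GRing.Theory Num.Theory.
Import numFieldNormedType.Exports.

Local Open Scope classical_set_scope.
Local Open Scope ring_scope.

(** * Integration against signed measures *)

(** The measures [mu] and [nu] may be singular, so no density can be compared pointwise: only their
    values on sets are controlled, by the sign condition and by (iv). Passing from sets to bounded
    test functions is the recurrent obstacle. One freezing argument, [signed_integral_pairing_ge0],
    settles every case: the sign of [<G, nu + c I>], condition (iv) tested with a function, and the
    linearity of an integral in its measure, which is not immediate because each charge comes with
    its own Hahn decomposition. Admissibility of the pair rests on the commutation of time and space
    derivatives. In the two tested identities [mu] carries the same coefficient [theta (w - v)], so
    it drops out of their difference. Exponentials are the natural [theta]: since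
    [- theta' = lam theta], the coefficient of [W] is [theta (lam H + h - 2 c)], and
    [H >= a (T - t)] makes it nonnegative up to any fixed time before [T] once [lam] is large. The
    subsolution may reach vacuum, so the convexity of the flux is needed down to density zero. *)

Section bounded_measurable.
Context dX (X : measurableType dX) (R : realType).
Implicit Types (A D : set X) (f g : X -> R).

(** The class of integrands used throughout: the measures at hand are finite on the sets considered,
    so these functions are integrable, and they form an algebra. *)
Definition bounded_measurable D f :=
  measurable_fun D f /\ exists M, forall x, D x -> `|f x| <= M.

Lemma bounded_measurableP D f : bounded_measurable D f ->
  exists2 M, 0 < M & forall x, D x -> `|f x| <= M.
Proof.
move=> [_ [M fM]]; exists (`|M| + 1); first by rewrite ltr_wpDl.
by move=> x /fM /le_trans; apply; rewrite (le_trans (ler_norm _))// lerDl.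
Qed.

Lemma bounded_measurableS D A f : measurable D -> A `<=` D ->
  bounded_measurable D f -> bounded_measurable A f.
Proof.
move=> mD AD [mf [M fM]]; split; first exact: measurable_funS mf.
by exists M => x /AD; exact: fM.
Qed.

Lemma bounded_measurable_cst D c : bounded_measurable D (cst c).
Proof. by split; [exact: measurable_cst | exists `|c|]. Qed.

Lemma bounded_measurableD D f g : bounded_measurable D f ->
  bounded_measurable D g -> bounded_measurable D (fun x => f x + g x).
Proof.
move=> [mf [M fM]] [mg [N gN]]; split; first exact: measurable_funD.
by exists (M + N) => x Dx; rewrite (le_trans (ler_normD _ _))// lerD// ?fM ?gN.
Qed.

Lemma bounded_measurableM D f g : bounded_measurable D f ->
  bounded_measurable D g -> bounded_measurable D (fun x => f x * g x).
Proof.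
move=> [mf [M fM]] [mg [N gN]]; split; first exact: measurable_funM.
by exists (M * N) => x Dx; rewrite normrM ler_pM// ?fM ?gN.
Qed.

Lemma bounded_measurableN D f :
  bounded_measurable D f -> bounded_measurable D (fun x => - f x).
Proof.
move=> [mf [M fM]]; split; first exact: measurableT_comp.
by exists M => x Dx; rewrite normrN fM.
Qed.

Lemma bounded_measurableB D f g : bounded_measurable D f ->
  bounded_measurable D g -> bounded_measurable D (fun x => f x - g x).
Proof. by move=> bf bg; apply/bounded_measurableD/bounded_measurableN. Qed.

Lemma bounded_measurable_sum (J : Type) (s : seq J) (Q : pred J) D
    (f : J -> X -> R) :
  (forall j, bounded_measurable D (f j)) ->
  bounded_measurable D (fun x => \sum_(j <- s | Q j) f j x).
Proof.
move=> bf; elim: s => [|j s IHs].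
  by under eq_fun do rewrite big_nil; exact: bounded_measurable_cst.
under eq_fun do rewrite big_cons.
by case: (Q j) => //; exact: bounded_measurableD.
Qed.

Lemma eq_bounded_measurable D f g : (forall x, D x -> f x = g x) ->
  bounded_measurable D f -> bounded_measurable D g.
Proof.
move=> fg [mf [M fM]]; split; last by exists M => x Dx; rewrite -fg ?fM.
by apply: eq_measurable_fun mf => x /[!inE] Dx; exact: fg.
Qed.

Lemma bounded_measurable_integrable_lty (m : {measure set X -> \bar R}) D f :
  measurable D -> (m D < +oo)%E -> bounded_measurable D f ->
  m.-integrable D (EFin \o f).
Proof.
move=> mD mDoo [mf [M fM]]; apply: measurable_bounded_integrable => //.
exists M; split; first exact: num_real.
by move=> N MN x Dx; exact: le_trans (fM x Dx) (ltW MN).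
Qed.

Lemma bounded_measurable_integrable (a : {finite_measure set X -> \bar R}) D f :
  measurable D -> bounded_measurable D f -> a.-integrable D (EFin \o f).
Proof.
move=> mD bf; apply: bounded_measurable_integrable_lty => //.
by rewrite -ge0_fin_numE// fin_num_measure.
Qed.

Lemma Rintegral_bounded_lty (m : {measure set X -> \bar R}) D f e :
  measurable D -> (m D < +oo)%E -> bounded_measurable D f ->
  (forall x, D x -> `|f x| <= e) ->
  `|\int[m]_(x in D) f x| <= e * fine (m D).
Proof.
move=> mD mDoo bf fe; have fint := bounded_measurable_integrable_lty mD mDoo bf.
apply: (le_trans (le_normr_Rintegral mD fint)).
rewrite -Rintegral_cst//; apply: le_Rintegral => //.
- exact: integrable_norm.
- exact/bounded_measurable_integrable_lty/bounded_measurable_cst.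
Qed.

Lemma Rintegral_bounded (a : {finite_measure set X -> \bar R}) D f e :
  measurable D -> bounded_measurable D f -> (forall x, D x -> `|f x| <= e) ->
  `|\int[a]_(x in D) f x| <= e * fine (a D).
Proof.
move=> mD; apply: Rintegral_bounded_lty => //.
by rewrite -ge0_fin_numE// fin_num_measure.
Qed.

End bounded_measurable.

(* An integral over the subsets of [D] against a difference of finite measures,
   [I A f] being the integral of [f] over [A]. *)
Definition signed_integral dX (X : measurableType dX) (R : realType)
    (D : set X) (I : set X -> (X -> R) -> R) :=
  exists a b : {finite_measure set X -> \bar R},
    forall A f, measurable A -> A `<=` D -> bounded_measurable A f ->
      I A f = \int[a]_(x in A) f x - \int[b]_(x in A) f x.

Section signed_integral.
Context dX (X : measurableType dX) (R : realType) (D : set X).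
Hypothesis mD : measurable D.
Implicit Types (A : set X) (f g : X -> R) (I : set X -> (X -> R) -> R).

Lemma signed_integralD I A f g : signed_integral D I -> measurable A ->
  A `<=` D -> bounded_measurable A f -> bounded_measurable A g ->
  I A (fun x => f x + g x) = I A f + I A g.
Proof.
move=> [a [b Iab]] mA AD bf bg; rewrite !Iab//; last exact: bounded_measurableD.
rewrite !RintegralD//; try exact: bounded_measurable_integrable.
by lra.
Qed.

Lemma signed_integralZ I A k f : signed_integral D I -> measurable A ->
  A `<=` D -> bounded_measurable A f -> I A (fun x => k * f x) = k * I A f.
Proof.
move=> [a [b Iab]] mA AD bf; rewrite !Iab//; last first.
  exact/bounded_measurableM/bf/bounded_measurable_cst.
rewrite !RintegralZl//; try exact: bounded_measurable_integrable.
by lra.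
Qed.

Lemma signed_integralN I A f : signed_integral D I -> measurable A ->
  A `<=` D -> bounded_measurable A f -> I A (fun x => - f x) = - I A f.
Proof.
move=> sI mA AD bf; rewrite -mulN1r -(signed_integralZ _ sI)//.
by congr I; apply/funext => x; rewrite mulN1r.
Qed.

Lemma eq_signed_integral I A f g : signed_integral D I -> measurable A ->
  A `<=` D -> bounded_measurable A f -> (forall x, A x -> f x = g x) ->
  I A f = I A g.
Proof.
move=> [a [b Iab]] mA AD bf fg; rewrite !Iab//; last first.
  exact: eq_bounded_measurable bf.
by congr (_ - _); apply: eq_Rintegral => x /[!inE]; exact: fg.
Qed.

Lemma signed_integral_sum (J : Type) (s : seq J) I A (f : J -> X -> R) :
  signed_integral D I -> measurable A -> A `<=` D ->
  (forall j, bounded_measurable A (f j)) ->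
  I A (fun x => \sum_(j <- s) f j x) = \sum_(j <- s) I A (f j).
Proof.
move=> sI mA AD bf; elim: s => [|j s IHs].
  rewrite big_nil; have := signed_integralZ 0 sI mA AD (bounded_measurable_cst A 0).
  rewrite mul0r => E; rewrite -[RHS]E; congr I; apply/funext => x.
  by rewrite big_nil mul0r.
rewrite big_cons -IHs -(signed_integralD sI)//; last exact: bounded_measurable_sum.
by congr I; apply/funext => x; rewrite big_cons.
Qed.

Lemma signed_integral_partition (K : finType) (S : K -> set X) I f :
  signed_integral D I -> (forall k, measurable (S k)) -> trivIset setT S ->
  D = \bigcup_k S k -> bounded_measurable D f ->
  I D f = \sum_k I (S k) f.
Proof.
move=> [a [b Iab]] mS tS DS bf.
have SD k : S k `<=` D by rewrite DS => x Sx; exists k.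
have DS' : D = \big[setU/set0]_(k <- index_enum K) S k.
  rewrite -bigcup_seq DS; apply: eq_bigcupl; split=> k //= _.
  exact: mem_index_enum.
have part (c : {finite_measure set X -> \bar R}) :
    \int[c]_(x in D) f x = \sum_k \int[c]_(x in S k) f x.
  rewrite /Rintegral {1}DS' integral_bigsetU_EFin//=.
  - rewrite -sum_fine// => k _; apply: integrable_fin_num => //.
    exact/bounded_measurable_integrable/(bounded_measurableS mD (SD k)).
  - exact: index_enum_uniq.
  - exact: sub_trivIset tS.
  - by rewrite -DS'; apply/measurable_EFinP; case: bf.
rewrite Iab// !part -sumrB; apply: eq_bigr => k _; rewrite Iab//.
exact: (bounded_measurableS mD (SD k)).
Qed.

Lemma signed_integral_le I : signed_integral D I ->
  exists C, 0 <= C /\ forall f e, bounded_measurable D f ->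
    (forall x, D x -> `|f x| <= e) -> `|I D f| <= e * C.
Proof.
move=> [a [b Iab]]; exists (fine (a D) + fine (b D)); split.
  by rewrite addr_ge0// fine_ge0.
move=> f e bf fe; rewrite Iab// (le_trans (ler_normB _ _))// mulrDr.
by rewrite lerD// Rintegral_bounded.
Qed.

End signed_integral.

Section signed_integral_pairing.
Context dX (X : measurableType dX) (R : realType) (D : set X).
Hypothesis mD : measurable D.
Variables (J : finType) (I : J -> set X -> (X -> R) -> R) (f g : J -> X -> R).
Hypothesis sI : forall j, signed_integral D (I j).
Hypothesis bf : forall j, bounded_measurable D (f j).
Hypothesis bg : forall j, bounded_measurable D (g j).

(** Each [g j] is cut into bands of height [e], and a cell of the partition records one band number
    for every [j]. Boundedness leaves finitely many bands. *)
Let level_partition e : 0 < e -> exists (K : finType) (S : K -> set X),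
  [/\ forall k, measurable (S k), trivIset setT S, D = \bigcup_k S k &
      forall k x y j, S k x -> S k y -> `|g j x - g j y| <= e].
Proof.
move=> e0.
have /choice[M Mg] j : exists M, forall x, D x -> `|g j x| <= M.
  by have [_] := bg j.
(* Adding the bound [M j] makes the quotient nonnegative, as truncation to a natural number
   requires. *)
pose lev j x := Num.truncn ((g j x + M j) / e).
have lev0 j x : D x -> 0 <= (g j x + M j) / e.
  move=> Dx; apply: divr_ge0; last exact: ltW.
  by have := Mg j x Dx; rewrite ler_norml -lerBlDr sub0r => /andP[].
pose n := (\max_j Num.truncn ((M j + M j) / e))%N.
have lev_le j x : D x -> (lev j x < n.+1)%N.
  move=> Dx; rewrite ltnS.
  apply: leq_trans (leq_bigmax j); apply: le_truncn.
  rewrite ler_pM2r ?invr_gt0// lerD2r.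
  by have := Mg j x Dx; rewrite ler_norml => /andP[].
pose S (k : {ffun J -> 'I_n.+1}) :=
  D `&` \bigcap_(j in setT)
    (D `&` [set x | (k j)%:R <= (g j x + M j) / e < (k j).+1%:R]).
have S_lev k x : S k x -> forall j, lev j x = k j.
  move=> [_ Sx] j; have {}Sx := Sx j Logic.I; by apply: truncn_def; case: Sx.
exists {ffun J -> 'I_n.+1}, S; split.
- move=> k; apply: measurableI => //; apply: fin_bigcap_measurable => [|j _].
    exact: finite_finset.
  have mlev : measurable_fun D (fun x => (g j x + M j) / e).
    by apply: measurable_funM => //; apply: measurable_funD => //; case: (bg j).
  have := mlev mD _ (measurable_itv `[(k j)%:R, (k j).+1%:R[).
  by congr measurable; apply/seteqP; split => x [Dx]; rewrite /= in_itv.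
- apply/trivIsetP => k l _ _ kl; apply/seteqP; split => // x [Skx Slx].
  move/eqP: kl; apply; apply/ffunP => j; apply/val_inj.
  by rewrite /= -(S_lev k x)// -(S_lev l x).
- apply/seteqP; split => [x Dx|x [k _ []]//].
  exists [ffun j => inord (lev j x)] => //; split => // j _ /=; split => //.
  by rewrite ffunE inordK ?lev_le// truncn_itv// lev0.
- move=> k x y j [_ /(_ j Logic.I)[_ ]] + [_ /(_ j Logic.I)[_ ]].
  rewrite /= !ler_pdivlMr// !ltr_pdivrMr// -natr1 mulrDl mul1r.
  by move=> /andP[? ?] /andP[? ?]; rewrite ler_norml; apply/andP; split; lra.
Qed.

(* [g] is replaced by a function which is constant on the cells of a partition
   into level sets, and on each cell equal to the value of [g] at some point. *)
Lemma signed_integral_pairing_ge0 :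
  (forall x A, D x -> measurable A -> A `<=` D ->
    0 <= \sum_j g j x * I j A (f j)) ->
  0 <= \sum_j I j D (fun x => g j x * f j x).
Proof.
move=> pos.
have /choice[C IC] j := signed_integral_le mD (sI j).
have /choice[F bF] j : exists M, 0 <= M /\ forall x, D x -> `|f j x| <= M.
  by have [M M0 fM] := bounded_measurableP (bf j); exists M; split => //; exact: ltW.
pose B := \sum_j F j * C j.
have B0 : 0 <= B.
  by apply: sumr_ge0 => j _; rewrite mulr_ge0//; [case: (bF j)|case: (IC j)].
(* An arbitrary error [e'] is allowed. Bands of height [e] cost at most [e * B]; the [+ 1] avoids a
   division by zero. *)
apply/ler_addgt0Pr => e' e'0; pose e := e' / (B + 1).
have B1 : 0 < B + 1 by rewrite ltr_wpDl.
have e0 : 0 < e by rewrite divr_gt0.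
have eB : e * B <= e'.
  by rewrite -[leRHS](divfK (lt0r_neq0 B1)) ler_wpM2l ?(ltW e0)// lerDl.
have [K [S [mS tS DS gS]]] := level_partition e0.
have SD k : S k `<=` D by rewrite DS => x Sx; exists k.
(* The sample point depends on the cell only, not on [j]: [pos] needs all the [g j] at the same
   point. Empty cells get the value 0. *)
pose c j k := if pselect (exists x, S k x) is left Sx then g j (sval (cid Sx)) else 0.
pose h j x := \sum_k c j k * \1_(S k) x.
have hS j k x : S k x -> h j x = c j k.
  move=> Skx; rewrite /h (bigD1 k)//= indicE mem_set// mulr1 big1 ?addr0// => l lk.
  rewrite indicE memNset ?mulr0// => Slx.
  have /trivIsetP/(_ l k Logic.I Logic.I lk) := tS.
  by apply/eqP/set0P; exists x.
have bh j : bounded_measurable D (h j).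
  apply: bounded_measurable_sum => k.
  apply: bounded_measurableM; first exact: bounded_measurable_cst.
  split; first exact: measurable_indic.
  by exists 1 => x _; rewrite indicE ger0_norm// lern1 leq_b1.
have step k : 0 <= \sum_j c j k * I j (S k) (f j).
  rewrite /c; case: pselect => [Sk|Sk]; last by rewrite big1// => j _; rewrite mul0r.
  by apply: pos => //; apply: SD; exact: svalP (cid Sk).
have -> : \sum_j I j D (fun x => g j x * f j x) =
    \sum_j I j D (fun x => (g j x - h j x) * f j x) +
    \sum_k \sum_j c j k * I j (S k) (f j).
  rewrite exchange_big -big_split; apply: eq_bigr => j _ /=.
  have -> : \sum_k c j k * I j (S k) (f j) = I j D (fun x => h j x * f j x).
    rewrite (signed_integral_partition mD (sI j) mS tS DS); last exact: bounded_measurableM.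
    apply: eq_bigr => k _; have bfS := bounded_measurableS mD (SD k) (bf j).
    rewrite -(signed_integralZ _ (sI j))//.
    apply: (eq_signed_integral (sI j)) => //.
      exact/bounded_measurableM/bfS/bounded_measurable_cst.
    by move=> x Skx; rewrite (hS j k).
  rewrite -(signed_integralD (sI j))//; first last.
  - exact: bounded_measurableM.
  - exact/bounded_measurableM/bf/bounded_measurableB.
  by congr I; apply/funext => x; rewrite -mulrDl subrK.
have small : `|\sum_j I j D (fun x => (g j x - h j x) * f j x)| <= e * B.
  apply: (le_trans (ler_norm_sum _ _ _)); rewrite mulr_sumr; apply: ler_sum => j _.
  rewrite mulrA; apply: (IC j).2.
    exact/bounded_measurableM/bf/bounded_measurableB.
  move=> x Dx; rewrite normrM ler_pM//; last by case: (bF j) => _; apply.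
  move: Dx; rewrite {1}DS => -[k _ Skx]; rewrite (hS j k)// /c.
  case: pselect => [Sk|[]]; last by exists x.
  exact: gS Skx (svalP (cid Sk)).
have : 0 <= \sum_k \sum_j c j k * I j (S k) (f j) by apply: sumr_ge0.
move: small; rewrite ler_norml => /andP[? _] ?.
by lra.
Qed.

End signed_integral_pairing.

(** The nonnegative case applies to [g] and to [- g]. This turns an identity between set functions
    into one between integrals, without comparing Jordan decompositions. *)
Lemma signed_integral_pairing_eq0 dX (X : measurableType dX) (R : realType)
    (D : set X) (J : finType) (I : J -> set X -> (X -> R) -> R) (f : J -> X -> R)
    (g : X -> R) :
  measurable D -> (forall j, signed_integral D (I j)) ->
  (forall j, bounded_measurable D (f j)) -> bounded_measurable D g ->
  (forall A, measurable A -> A `<=` D -> \sum_j I j A (f j) = 0) ->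
  \sum_j I j D (fun x => g x * f j x) = 0.
Proof.
move=> mD sI bf bg I0.
apply/eqP; rewrite eq_le; apply/andP; split; last first.
  apply: (@signed_integral_pairing_ge0 _ _ _ _ _ _ _ _ (fun=> g)) => // x A _ mA AD.
  by rewrite -mulr_sumr I0// mulr0.
rewrite -oppr_ge0 -sumrN.
have -> : \sum_j - I j D (fun x => g x * f j x) =
    \sum_j I j D (fun x => - g x * f j x).
  apply: eq_bigr => j _; rewrite -(signed_integralN (sI j))//.
    by congr I; apply/funext => x; rewrite mulNr.
  exact: bounded_measurableM.
apply: (@signed_integral_pairing_ge0 _ _ _ _ _ _ _ _ (fun=> fun x => - g x)) => //.
  by move=> j; exact: bounded_measurableN.
by move=> x A _ mA AD; rewrite -mulr_sumr I0// mulr0.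
Qed.

Section charges.
Context dX (X : measurableType dX) (R : realType) (D : set X).
Hypothesis mD : measurable D.

Lemma signed_charge_integral (nu : {charge set X -> \bar R}) :
  signed_integral D (charge_integral nu).
Proof.
rewrite /charge_integral; set nuPN := projT2 _.
by exists (jordan_pos nuPN), (jordan_neg nuPN).
Qed.

Lemma charge_integral_cst1 (nu : {charge set X -> \bar R}) (A : set X) :
  measurable A -> charge_integral nu A (cst 1) = fine (nu A).
Proof.
move=> mA; rewrite /charge_integral; set nuPN := projT2 _.
rewrite !Rintegral_cst// !mul1r (jordan_decomp nuPN mA) /= /cadd /=.
rewrite cscaleN1 /copp/= fineD ?fineN ?fin_numN//; exact: fin_num_measure.
Qed.

Lemma signed_Rintegral (m : {measure set X -> \bar R}) :
  (m D < +oo)%E -> signed_integral D (Rintegral m).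
Proof.
move=> mDoo.
have m0oo : (m set0 < +oo)%E by rewrite measure0.
(* The negative part is the zero measure, written as a restriction to the empty set so that it
   carries the structure of a finite measure. *)
exists (mfrestr mD mDoo), (mfrestr measurable0 (m0oo)) => A f mA AD bf.
have -> : \int[mfrestr measurable0 (m0oo)]_(x in A) f x = 0.
  rewrite /Rintegral (eq_measure_integral mzero) ?integral_measure_zero// => B mB BA.
  by rewrite /= /mfrestr /mrestr setI0 measure0.
rewrite subr0; congr fine; apply: eq_measure_integral => B mB BA.
by rewrite /= /mfrestr /mrestr setIidl//; exact: subset_trans AD.
Qed.

Lemma signed_integral_charge I f : signed_integral D I ->
  bounded_measurable D f -> exists E : {charge set X -> \bar R},
    forall A, measurable A -> A `<=` D -> E A = (I A f)%:E.
Proof.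
move=> [a [b Iab]] bf.
(* Nothing is known of [f] outside [D]; extension by zero gives the integrability on the whole space
   that [induced_charge] asks for. *)
have fint (c : {finite_measure set X -> \bar R}) :
    c.-integrable setT ((EFin \o f) \_ D).
  by rewrite -integrable_mkcond//; exact: bounded_measurable_integrable.
exists (cadd (induced_charge (fint a)) (copp (induced_charge (fint b)))).
move=> A mA AD; have bfA := bounded_measurableS mD AD bf.
rewrite Iab// /cadd /= /copp /= /induced_charge.
have E (c : {finite_measure set X -> \bar R}) :
    (\int[c]_(x in A) ((EFin \o f) \_ D) x = (\int[c]_(x in A) f x)%:E)%E.
  rewrite /Rintegral fineK; last first.
    by apply: integrable_fin_num => //; exact: bounded_measurable_integrable.
  apply: eq_integral => x /[!inE] /AD Dx; rewrite patchE mem_set//.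
by rewrite EFinB -!E.
Qed.

Lemma signed_integral_charge_sum (J : Type) (s : seq J)
    (I : J -> set X -> (X -> R) -> R) (f : J -> X -> R) :
  (forall j, signed_integral D (I j)) ->
  (forall j, bounded_measurable D (f j)) ->
  exists E : {charge set X -> \bar R}, forall A, measurable A -> A `<=` D ->
    E A = (\sum_(j <- s) I j A (f j))%:E.
Proof.
move=> sI bf; elim: s => [|j s [E IHE]].
  by exists czero => A mA AD; rewrite big_nil.
have [E' EE'] := signed_integral_charge (sI j) (bf j).
exists (cadd E' E) => A mA AD.
by rewrite big_cons EFinD -EE'// -IHE.
Qed.

(** The charge [E] is adjoined to the family as the index [None] with density [-1]. The hypothesis
    then says that the enlarged family sums to zero on every set, and [signed_integral_pairing_eq0]
    allows multiplication by [g]. *)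
Lemma charge_integralE (J : finType) (I : J -> set X -> (X -> R) -> R)
    (f : J -> X -> R) (E : {charge set X -> \bar R}) (g : X -> R) :
  (forall j, signed_integral D (I j)) ->
  (forall j, bounded_measurable D (f j)) ->
  (forall A, measurable A -> A `<=` D -> fine (E A) = \sum_j I j A (f j)) ->
  bounded_measurable D g ->
  charge_integral E D g = \sum_j I j D (fun x => g x * f j x).
Proof.
move=> sI bf EI bg.
pose I' (o : option J) := oapp I (charge_integral E) o.
pose f' (o : option J) := oapp f (cst (-1)) o.
have sI' o : signed_integral D (I' o).
  by case: o => [j|]; [exact: sI | exact: signed_charge_integral].
have bf' o : bounded_measurable D (f' o).
  by case: o => [j|]; [exact: bf | exact: bounded_measurable_cst].
have big_o (F : option J -> R) : \sum_o F o = F None + \sum_j F (Some j).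
  rewrite (bigD1 None)//=; congr (_ + _).
  rewrite (reindex_omap Some id) => [|[]//].
  by apply: eq_bigl => j /=; rewrite eqxx.
have neg (A : set X) (h : X -> R) : measurable A -> A `<=` D ->
    bounded_measurable A h ->
    charge_integral E A (fun x => h x * -1) = - charge_integral E A h.
  move=> mA AD bh; rewrite -(signed_integralN (signed_charge_integral E))//.
  by congr charge_integral; apply/funext => x; rewrite mulrN1.
have := signed_integral_pairing_eq0 mD sI' bf' bg.
rewrite big_o /= neg// addrC => H; apply/esym/eqP; rewrite -subr_eq0; apply/eqP.
apply: H => A mA AD; rewrite big_o /=.
have -> : charge_integral E A (cst (-1)) = - charge_integral E A (cst 1).
  rewrite -(neg A (cst 1) mA AD (bounded_measurable_cst _ _)).
  by congr (charge_integral _ _ _); apply/funext => x; rewrite /= mul1r.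
by rewrite charge_integral_cst1// EI// addNr.
Qed.

End charges.

(** * Measurability on space-time *)

Section slab.
Context {R : realType} (d : nat) (T : R).
Local Notation ST := (R * 'rV[R]_d)%type.
Local Notation X := (@measurable_spacetime R d).

Lemma measurable_unit_cell : measurable (@unit_cell R d).
Proof.
rewrite (_ : @unit_cell R d = \bigcap_(i in setT)
    ((fun x : 'rV[R]_d => x 0 i) @^-1` `[0, 1[%classic)); last first.
  apply/seteqP; split => x /= xi i; last by have := xi i Logic.I; rewrite /= in_itv.
  by move=> _; rewrite /= in_itv; exact: xi.
apply: fin_bigcap_measurable => [|i _]; first exact: finite_finset.
by rewrite -[X in measurable X]setTI; exact: measurable_entry.
Qed.

Lemma measurable_cell : measurable (@cell R d T : set X).
Proof. by apply: measurableX; [exact: measurable_itv | exact: measurable_unit_cell]. Qed.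

Let grid (n : nat) (k : nat * {ffun 'I_d -> nat}) : ST :=
  (k.1%:R / n.+1%:R, \row_i ((k.2 i)%:R / n.+1%:R)).

Let round (n : nat) (p : ST) : nat * {ffun 'I_d -> nat} :=
  (Num.truncn (p.1 * n.+1%:R), [ffun i => Num.truncn (p.2 0 i * n.+1%:R)]).

Let round_le (n : nat) (y : R) : 0 <= y ->
  (Num.truncn (y * n.+1%:R))%:R / n.+1%:R <= y <=
  (Num.truncn (y * n.+1%:R))%:R / n.+1%:R + n.+1%:R^-1.
Proof.
move=> y0; have n0 : 0 < n.+1%:R :> R by rewrite ltr0n.
have /andP[l u] := @truncn_itv _ (y * n.+1%:R) (mulr_ge0 y0 (ltW n0)).
rewrite ler_pdivrMr// l/= -[X in _ + X]mul1r -mulrDl ler_pdivlMr//.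
by rewrite natr1 ltW.
Qed.

Let cell_ge0 (p : ST) : cell T p -> 0 <= p.1 <= T /\ forall i, 0 <= p.2 0 i < 1.
Proof. by move=> [/=]; rewrite in_itv. Qed.

Let grid_slab n p : cell T p -> slab T (grid n (round n p)).
Proof.
move=> /cell_ge0[/andP[p0 pT] _]; split => //=; rewrite in_itv /=.
have /andP[l _] := round_le n p0.
by rewrite mulr_ge0 ?invr_ge0//= (le_trans l).
Qed.

Let cvg_grid p : cell T p -> grid n (round n p) @[n --> \oo] --> p.
Proof.
move=> /cell_ge0[/andP[p0 pT] pi]; apply/cvg_ballP => e e0.
near=> n.
have ne : n.+1%:R^-1 < e.
  by near: n; exact: (near_infty_natSinv_lt (PosNum e0)).
have close (y : R) : 0 <= y -> ball y e ((Num.truncn (y * n.+1%:R))%:R / n.+1%:R).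
  move=> y0; have /andP[l u] := round_le n y0.
  by rewrite /ball /= ger0_norm ?subr_ge0// ltrBlDl (le_lt_trans u)// ltrD2l.
split; first exact: close.
split => // i j; rewrite /= mxE ffunE (ord1 i); apply: close.
by have /andP[] := pi j.
Unshelve. all: by end_near. Qed.

Let measurable_round n k : measurable (cell T `&` [set p : X | round n p = k]).
Proof.
rewrite (_ : _ `&` _ = cell T `&`
  (((fun p : X => p.1 * n.+1%:R) @^-1` `[k.1%:R, k.1.+1%:R[%classic) `&`
  \bigcap_(i in setT) ((fun p : X => p.2 0 i * n.+1%:R) @^-1`
    `[(k.2 i)%:R, (k.2 i).+1%:R[%classic))).
  apply: measurableI; first exact: measurable_cell.
  apply: measurableI.
    rewrite -[X in measurable X]setTI.
    have mf : measurable_fun setT (fun p : X => p.1 * n.+1%:R).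
      by apply: measurable_funM => //; exact: measurable_fst.
    by apply: mf => //; exact: measurable_itv.
  apply: fin_bigcap_measurable => [|i _]; first exact: finite_finset.
  rewrite -[X in measurable X]setTI.
  have mf : measurable_fun setT (fun p : X => p.2 0 i * n.+1%:R).
    apply: measurable_funM => //; apply: (measurableT_comp (measurable_entry 0 i)).
    exact: measurable_snd.
  by apply: mf => //; exact: measurable_itv.
apply/seteqP; split => p [cp].
  move=> /= rp; split => //; rewrite -rp; have [/andP[p0 _] pi] := cell_ge0 cp; split.
    by rewrite /= in_itv/= truncn_itv// mulr_ge0.
  by move=> i _ /=; rewrite ffunE in_itv/= truncn_itv// mulr_ge0//; have /andP[] := pi i.
move=> [/=]; rewrite in_itv/= => rp pi; split => //=.
rewrite /round (truncn_def rp) [RHS]surjective_pairing; congr pair; apply/ffunP => i.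
by rewrite ffunE; apply: truncn_def; have := pi i Logic.I; rewrite /= in_itv.
Qed.

Let measurable_step n (g : nat * {ffun 'I_d -> nat} -> R) :
  measurable_fun (cell T : set X) (fun p => g (round n p)).
Proof.
move=> _ B mB.
(* Grid indices are countable, so the preimage is a union over their codes. A number that codes no
   index, or an index whose value misses [B], contributes [set0]. *)
pose F (m : nat) : set X :=
  if @unpickle (nat * {ffun 'I_d -> nat})%type m is Some k then
    if `[< B (g k) >] then cell T `&` [set p | round n p = k] else set0
  else set0.
rewrite (_ : _ `&` _ = \bigcup_m F m).
  apply: bigcup_measurable => m _; rewrite /F.
  case: unpickle => [k|//]; case: ifP => // _; exact: measurable_round.
apply/seteqP; split => p.
  move=> [cp Bp]; exists (pickle (round n p)) => //.
  by rewrite /F pickleK; move/asboolP : Bp => /= ->.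
move=> [m _]; rewrite /F; case: unpickle => // k; case: ifP => // /asboolP Bk.
by move=> [cp /= rp]; split => //=; rewrite rp.
Qed.

(** Measurability: [f] is the pointwise limit of its compositions with rounding to the grid of mesh
    [1 / (n + 1)], which take countably many values on sets described by coordinates. Rounding down
    keeps times in [[0, T]], where continuity is known. Boundedness: the half-open cell lies in a
    compact subset of the slab. *)
Lemma slab_bounded_measurable (f : ST -> R) : {within slab T, continuous f} ->
  bounded_measurable (cell T : set X) f.
Proof.
move=> cf; split.
  apply: (@measurable_fun_cvg _ X _ _ (fun n p => f (grid n (round n p)))).
    by move=> n; exact: (measurable_step n (f \o grid n)).
  move=> p cp; have sp : slab T p by case: cp.
  have fp := (subspace_continuousP _ _).1 cf p sp.
  refine (@cvg_comp _ _ _ (fun n => grid n (round n p)) f \oo _ _ _ fp) => A /= wA.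
  have gA : \forall n \near \oo, slab T (grid n (round n p)) -> A (grid n (round n p)).
    exact: cvg_grid cp _ wA.
  by apply: filterS gA => n; apply; exact: grid_slab.
pose C : set ST := `[0, T] `*` [set x : 'rV[R]_d | forall i, `[0, 1]%classic (x ord0 i)].
have cC : compact C.
  apply: compact_setX; first exact: segment_compact.
  exact: (@rV_compact R d (fun=> `[0, 1]%classic) (fun=> @segment_compact R 0 1)).
have CS : C `<=` slab T by move=> p [].
have /compact_bounded[M [_ fM]] := continuous_compact (continuous_subspaceW CS cf) cC.
have M1 : M < M + 1 by rewrite ltrDl.
exists (M + 1) => p [p1 p2]; have /= := fM _ M1 (f p); apply.
exists p => //; split => // i /=; have /andP[? ?] := p2 i.
by rewrite in_itv /=; apply/andP; split => //; exact: ltW.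
Qed.

End slab.

Lemma lebesgue_unit_cell_lty {R : realType} d :
  (lebesgue_rV d (@unit_cell R d) < +oo)%E.
Proof.
elim: d => [|d IHd] /=; first by rewrite diracE ltry.
rewrite /lebesgue_rV_step /pushforward.
rewrite (_ : _ @^-1` _ = `[0, 1[%classic `*` @unit_cell R d); last first.
  apply/seteqP; split => -[a x] /=.
    move=> ax; split; first by have := ax ord0; rewrite mxE unlift_none/= in_itv.
    by move=> i; have := ax (lift ord0 i); rewrite mxE liftK.
  move=> [/=]; rewrite in_itv/= => a01 x01 i; rewrite mxE.
  by case: unliftP => [j|] _ //=.
rewrite product_measure1E//; last exact: measurable_unit_cell.
have := @lebesgue_measure_itv R `[0, 1[; rewrite /= lte01 sube0 => leb01.
by rewrite [X in (X * _)%E](_ : _ = 1%E) ?mul1e.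
Qed.

Lemma leb_cell_lty {R : realType} d (T : R) : (leb_spacetime d (cell T) < +oo)%E.
Proof.
rewrite /leb_spacetime /cell product_measure1E//; last exact: measurable_unit_cell.
have cell_fin : lebesgue_rV d (@unit_cell R d) \is a fin_num.
  by rewrite ge0_fin_numE ?lebesgue_unit_cell_lty.
have := @lebesgue_measure_itv R `[0, T] => /= lebT.
rewrite [X in (X * _)%E](_ : _ = lebesgue_measure `[0, T]%classic)// lebT.
by rewrite -(fineK cell_fin); case: ifPn => _; rewrite -?EFinB -EFinM ltry.
Qed.

(** * Derivatives *)

Section line_derivative.
Context {R : realType} {V W : normedModType R}.
Implicit Types (F : V -> W) (x u : V).

Let line_quotient F x u a :
  (fun h : R => h^-1 *: (F (h *: u + (a *: u + x)) - F (a *: u + x))) =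
  (fun h : R => h^-1 *: (F ((h *: 1 + a) *: u + x) - F (a *: u + x))).
Proof.
by apply/funext => h; rewrite [h *: 1]mulr1 scalerDl addrA.
Qed.

(** Smoothness is defined through directional derivatives; restriction to a line makes the
    one-variable chain rule and mean value theorem available. *)
Lemma is_derive_line F x u a : derivable F (a *: u + x) u ->
  is_derive a 1 (fun h : R => F (h *: u + x)) ('D_u F (a *: u + x)).
Proof.
have E : (fun h : R => h^-1 *: ((F \o shift (a *: u + x)) (h *: u) - F (a *: u + x))) =
    (fun h : R => h^-1 *: (((fun h : R => F (h *: u + x)) \o shift a) (h *: 1) -
       F (a *: u + x))) by exact: line_quotient.
rewrite /derivable /derive E => dF.
by apply: DeriveDef.
Qed.

Lemma is_derive_of_line F x u df :
  is_derive (0 : R) 1 (fun h : R => F (h *: u + x)) df -> is_derive x u F df.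
Proof.
have E : (fun h : R => h^-1 *: ((F \o shift x) (h *: u) - F x)) =
    (fun h : R => h^-1 *: (((fun h : R => F (h *: u + x)) \o shift 0) (h *: 1) -
       F (0 *: u + x))).
  by apply/funext => h /=; rewrite addr0 [h *: 1]mulr1 scale0r add0r.
move=> [dF <-]; apply: DeriveDef; first by rewrite /derivable E.
by rewrite /derive E.
Qed.

Lemma derive_line F x u : 'D_u F x = 'D_1 (fun h : R => F (h *: u + x)) 0.
Proof.
have := line_quotient F x u 0; rewrite scale0r add0r /derive => ->.
by rewrite /= scale0r add0r.
Qed.

End line_derivative.

Lemma is_derive_comp_real {R : realType} {V : normedModType R} (f : V -> R)
    (g : R -> R) (x w : V) (df dg : R) :
  is_derive x w f df -> is_derive (f x) 1 g dg ->
  is_derive x w (g \o f) (dg * df).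
Proof.
move=> [dfx fE] dgx; apply: is_derive_of_line.
have dl : is_derive (0 : R) 1 (fun h : R => f (h *: w + x)) df.
  rewrite -fE -[in 'D_w f x](add0r x) -(scale0r w).
  by apply: is_derive_line; rewrite scale0r add0r.
apply: (@is_derive1_comp _ g (fun h : R => f (h *: w + x)) 0 _ _ _ dl).
by rewrite scale0r add0r.
Qed.

Section mixed_derivatives.
Context {R : realType} {V : normedModType R}.
Implicit Types (F : V -> R) (u w p : V) (s : R).

(** Two mean value theorems: in direction [u] for the increment of [F] along [s *: w], then in
    direction [w] for ['D_u F]. *)
Let second_difference F u w p s : 0 < s ->
  (forall x, derivable F x u) -> (forall x, derivable ('D_u F) x w) ->
  exists a b, [/\ 0 < a < s, 0 < b < s &
    (F (s *: u + (s *: w + p)) - F (s *: u + p)) - (F (s *: w + p) - F p) =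
    s * s * 'D_w ('D_u F) (b *: w + (a *: u + p))].
Proof.
move=> s0 dF ddF.
have cont (f df : R -> R) : (forall x : R, is_derive x 1 f (df x)) ->
    {within `[0, s], continuous f}.
  move=> fdf; apply: derivable_within_continuous => x _.
  by case: (fdf x).
pose f a := F (a *: u + (s *: w + p)) - F (a *: u + p).
pose df a := 'D_u F (a *: u + (s *: w + p)) - 'D_u F (a *: u + p).
have fdf (x : R) : is_derive x 1 f (df x).
  by apply: is_deriveB; exact: is_derive_line.
have [a a0s] := MVT s0 (fun x _ => fdf x) (cont _ _ fdf).
pose g b := 'D_u F (b *: w + (a *: u + p)).
pose dg b := 'D_w ('D_u F) (b *: w + (a *: u + p)).
have gdg (x : R) : is_derive x 1 g (dg x) by exact: is_derive_line.
have [b b0s] := MVT s0 (fun x _ => gdg x) (cont _ _ gdg).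
rewrite /f /df /g /dg !scale0r !add0r !subr0 => Eg Ef.
exists a, b; split; first by rewrite in_itv in a0s.
  by rewrite in_itv in b0s.
by rewrite Ef addrCA Eg; lra.
Qed.

(** Schwarz's theorem for directional derivatives. The second difference is symmetric in [u] and
    [w], so some value of one mixed derivative near [p] equals some value of the other; continuity
    at [p] concludes. *)
Lemma derive_comm F u w p :
  (forall x, derivable F x u) -> (forall x, derivable F x w) ->
  (forall x, derivable ('D_u F) x w) -> (forall x, derivable ('D_w F) x u) ->
  continuous ('D_w ('D_u F)) -> continuous ('D_u ('D_w F)) ->
  'D_w ('D_u F) p = 'D_u ('D_w F) p.
Proof.
move=> dFu dFw dFuw dFwu cwu cuw.
have near0 (G : V -> R) (y z : V) e : continuous G -> 0 < e ->
    exists2 del, 0 < del & forall a b, 0 < a < del -> 0 < b < del ->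
      `|G p - G (b *: z + (a *: y + p))| < e.
  move=> cG e0; pose L (c : R * R) := G (c.2 *: z + (c.1 *: y + p)).
  have cL : {for (0, 0), continuous L}.
    apply: continuous_comp; last exact: cG.
    apply: cvgD; first by apply: cvgZr_tmp; exact: cvg_snd.
    by apply: cvgD; [apply: cvgZr_tmp; exact: cvg_fst | exact: cvg_cst].
  have /cvgrPdist_lt/(_ e e0)/nbhs_ballP[del /= del0 ball_del] := cL.
  exists del => // a b /andP[a0 ad] /andP[b0 bd].
  have := ball_del (a, b); rewrite /L /= !scale0r !add0r; apply.
  by split; rewrite /ball /= sub0r normrN gtr0_norm.
apply/eqP; rewrite -subr_eq0 -normr_le0; apply/ler_addgt0Pr => e e0; rewrite add0r.
have e20 : 0 < e / 2 by rewrite divr_gt0.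
have [d1 d10 near1] := near0 _ u w _ cwu e20.
have [d2 d20 near2] := near0 _ w u _ cuw e20.
pose s := Num.min d1 d2.
have s0 : 0 < s by rewrite lt_min d10.
have [a [b [/andP[a0 ad] /andP[b0 bd] E]]] := second_difference p s0 dFu dFuw.
have [a' [b' [/andP[a'0 a'd] /andP[b'0 b'd] E']]] := second_difference p s0 dFw dFwu.
have := near1 a b; rewrite a0 b0 (lt_le_trans ad) ?ge_min ?lexx//.
rewrite (lt_le_trans bd) ?ge_min ?lexx// => /(_ isT isT).
have := near2 a' b'; rewrite a'0 b'0 (lt_le_trans a'd) ?ge_min ?lexx ?orbT//.
rewrite (lt_le_trans b'd) ?ge_min ?lexx ?orbT// => /(_ isT isT).
have -> : 'D_u ('D_w F) (b' *: u + (a' *: w + p)) =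
          'D_w ('D_u F) (b *: w + (a *: u + p)).
  have s2 : s * s != 0 by rewrite mulf_neq0 ?gt_eqF.
  apply: (mulfI s2); apply: etrans (esym E') _; apply: etrans E.
  by rewrite [s *: w + (s *: u + p)]addrCA -!addrA; congr +%R; rewrite !opprD !opprK addrCA.
move: ('D_w ('D_u F) _) ('D_w ('D_u F) p) ('D_u ('D_w F) p) => z x y yz xz.
have -> : x - y = (x - z) - (y - z) by ring.
by rewrite (le_trans (ler_normB _ _))// (splitr e) lerD// ltW.
Qed.

End mixed_derivatives.

Section continuous_entries.
Context {R : realType} {V : topologicalType} {m n : nat}.

Lemma cvg_mxP {F : set_system V} {FF : Filter F} (f : V -> 'M[R]_(m, n))
    (A : 'M[R]_(m, n)) :
  (forall i j, f x i j @[x --> F] --> A i j) -> f @ F --> A.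
Proof.
move=> fA; apply/cvg_ballP => e e0.
have : \forall x \near F, forall i j, ball (A i j) e (f x i j).
  apply: filter_forall => i; apply: filter_forall => j.
  have := fA i j; move/cvg_ballP => /(_ e e0). exact.
by apply: filterS => x Ax; split.
Qed.

End continuous_entries.

Section cont_diff_theory.
Context {R : realType} {V : normedModType R}.

Lemma cont_diffW {W : normedModType R} k (f : V -> W) :
  cont_diff k.+1 f -> cont_diff k f.
Proof.
elim: k f => [|k IHk] f [cf df]; first by split.
by split=> // w; have [dfw /IHk] := df w.
Qed.

Lemma smooth_derive {W : normedModType R} (f : V -> W) w :
  smooth f -> smooth ('D_w f).
Proof. by move=> sf k; have [_ /(_ w)[]] := sf k.+1. Qed.

Lemma smooth_derivable {W : normedModType R} (f : V -> W) w x :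
  smooth f -> derivable f x w.
Proof. by move=> sf; have [_ /(_ w)[]] := sf 1%N. Qed.

Lemma smooth_continuous {W : normedModType R} (f : V -> W) :
  smooth f -> continuous f.
Proof. by move=> sf; have [] := sf 0%N. Qed.

Lemma cont_diff_mxP m n k (f : V -> 'M[R]_(m, n)) :
  cont_diff k f <-> forall i j, cont_diff k (fun x => f x i j).
Proof.
elim: k f => [|k IHk] f.
  split=> [[cf _] i j|cf]; split=> // x.
    exact: (@continuous_comp _ _ _ f (fun M : 'M[R]_(m, n) => M i j) x (cf x)
      (@coord_continuous _ _ _ i j (f x))).
  by apply: cvg_mxP => i j; have [c _] := cf i j; exact: c.
have DE w : (forall x, derivable f x w) ->
    forall i j, (fun x => 'D_w f x i j) = 'D_w (fun x => f x i j).
  by move=> df i j; apply/funext => x; rewrite derive_mx// mxE.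
split=> [[cf df] i j|cdf].
  split.
    move=> x; exact: (@continuous_comp _ _ _ f (fun M : 'M[R]_(m, n) => M i j) x
      (cf x) (@coord_continuous _ _ _ i j (f x))).
  move=> w; have [dfw cfw] := df w; split; first by move=> x; exact: (derivable_mxP _ _ _).1 (dfw x) i j.
  by rewrite -(DE w dfw i j); exact: (IHk _).1 cfw i j.
split; first by move=> x; apply: cvg_mxP => i j; have [c _] := cdf i j; exact: c.
move=> w; have df x : derivable f x w.
  by apply/derivable_mxP => i j; have [_ /(_ w)[]] := cdf i j.
split=> //; apply/IHk => i j; rewrite DE//.
by have [_ /(_ w)[]] := cdf i j.
Qed.

Lemma cont_diff_lin k (c : R) (f g : V -> R) :
  cont_diff k f -> cont_diff k g -> cont_diff k (fun x => c * f x + g x).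
Proof.
elim: k f g => [|k IHk] f g [cf df] [cg dg].
  by split=> // x; apply: cvgD; [apply: cvgM; [exact: cvg_cst|exact: cf]|exact: cg].
split; first by move=> x; apply: cvgD; [apply: cvgM; [exact: cvg_cst|exact: cf]|exact: cg].
move=> w; have [dfw cfw] := df w; have [dgw cgw] := dg w.
have D x : is_derive x w (fun x => c * f x + g x) (c * 'D_w f x + 'D_w g x).
  apply: is_deriveD; first by apply: is_deriveZ; exact: derivableP.
  exact: derivableP.
split; first by move=> x; case: (D x).
rewrite (_ : 'D_w _ = fun x => c * 'D_w f x + 'D_w g x); first exact: IHk.
by apply/funext => x; case: (D x).
Qed.

Lemma cont_diff_cst k (c : R) : cont_diff k (cst c : V -> R).
Proof.
elim: k c => [|k IHk] c; first by split=> // x; exact: cvg_cst.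
split; first by move=> x; exact: cvg_cst.
move=> w; split=> [x|]; first exact: derivable_cst.
by rewrite (_ : 'D_w _ = cst 0)//; apply/funext => x; exact: derive_cst.
Qed.

Lemma cont_diff_sum k (J : Type) (s : seq J) (f : J -> V -> R) :
  (forall j, cont_diff k (f j)) -> cont_diff k (fun x => \sum_(j <- s) f j x).
Proof.
move=> cf; elim: s => [|j s IHs].
  by under eq_fun do rewrite big_nil; exact: cont_diff_cst.
under eq_fun do rewrite big_cons.
have := cont_diff_lin 1 (cf j) IHs.
by under eq_fun do rewrite mul1r.
Qed.

End cont_diff_theory.

Section time_decay.
Context {R : realType} {V : normedModType R} (lam : R).
Local Notation decay := (fun p : R * V => expR (- lam * p.1)).

Lemma is_derive_decay (p w : R * V) :
  is_derive p w decay (- lam * w.1 * expR (- lam * p.1)).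
Proof.
have lin : is_derive p w (fun p : R * V => - lam * p.1) (- lam * w.1).
  apply: is_derive_of_line.
  rewrite (_ : (fun h : R => _) = fun h : R => - lam * w.1 * h + - lam * p.1).
    by apply: is_derive_eq; rewrite addr0 [_ *: _]mulr1.
  by apply/funext => h; rewrite /= mulrDr [h *: w.1]mulrC mulrA.
rewrite mulrC; exact: (is_derive_comp_real lin (is_derive_expR _)).
Qed.

(** A directional derivative of [decay * f] is again [decay] times a function, one order less
    regular than [f]. The induction therefore runs over all [f] at once. *)
Lemma cont_diff_decay k (f : R * V -> R) :
  cont_diff k f -> cont_diff k (fun p => expR (- lam * p.1) * f p).
Proof.
have cont (g : R * V -> R) : continuous g ->
    continuous (fun p : R * V => expR (- lam * p.1) * g p).
  move=> cg p; apply: cvgM; last exact: cg.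
  apply: (@continuous_comp _ _ _ (fun p : R * V => - lam * p.1) expR).
    by apply: cvgM; [exact: cvg_cst | exact: cvg_fst].
  exact: continuous_expR.
elim: k f => [|k IHk] f [cf df]; first by split=> //; exact: cont.
split; first exact: cont.
move=> w; have [dfw cfw] := df w.
have D p : is_derive p w (fun p => expR (- lam * p.1) * f p)
    (expR (- lam * p.1) * (- lam * w.1 * f p + 'D_w f p)).
  apply: (@is_derive_eq _ _ _ _ _ _ _ _ (is_deriveM (is_derive_decay p w) (derivableP (dfw p)))).
  by rewrite /GRing.scale /=; ring.
split; first by move=> p; case: (D p).
rewrite (_ : 'D_w _ = fun p => expR (- lam * p.1) * (- lam * w.1 * f p + 'D_w f p)).
  by apply: IHk; apply: cont_diff_lin => //; apply: cont_diffW; split.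
by apply/funext => p; case: (D p).
Qed.

End time_decay.

(** * Test functions on the slab and their damping in time *)

Section test_functions.
Context {R : realType} (d : nat).
Local Notation ST := (R * 'rV[R]_d)%type.
Implicit Types (w p : ST).

Lemma derive_mxE m n (Psi : ST -> 'M[R]_(m, n)) w p i j : smooth Psi ->
  'D_w Psi p i j = 'D_w (fun p => Psi p i j) p.
Proof. by move=> sPsi; rewrite derive_mx ?mxE//; exact: smooth_derivable. Qed.

Lemma smooth_entry m n (Psi : ST -> 'M[R]_(m, n)) i j :
  smooth Psi -> smooth (fun p => Psi p i j).
Proof. by move=> sPsi k; exact: (cont_diff_mxP _ _).1 (sPsi k) i j. Qed.

Lemma periodic_derive {W : normedModType R} (f : ST -> W) w :
  (forall t, Defs.periodic (fun x => f (t, x))) ->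
  forall t, Defs.periodic (fun x => 'D_w f (t, x)).
Proof.
move=> pf t x i; rewrite /derive.
have E : (fun h : R => h^-1 *: ((f \o shift (t, x + delta_mx 0 i)) (h *: w) -
      f (t, x + delta_mx 0 i))) =
    (fun h : R => h^-1 *: ((f \o shift (t, x)) (h *: w) - f (t, x))).
  apply/funext => h; congr (_ *: (_ - _)); last exact: pf.
  case: w => w1 w2; transitivity (f (h *: w1 + t, (h *: w2 + x) + delta_mx 0 i)).
    by rewrite -addrA.
  exact: pf.
by rewrite E.
Qed.

Lemma smooth_on_slab_derive {W : normedModType R} (f : ST -> W) w :
  smooth_on_slab f -> smooth_on_slab ('D_w f).
Proof. by move=> [pf sf]; split; [exact: periodic_derive | exact: smooth_derive]. Qed.

Lemma derive_sym n (Psi : ST -> 'M[R]_n) w : smooth Psi ->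
  (forall p, (Psi p)^T = Psi p) -> forall p, ('D_w Psi p)^T = 'D_w Psi p.
Proof.
move=> sPsi symPsi p; apply/matrixP => i j; rewrite mxE !derive_mxE//.
by congr ('D_w _ p); apply/funext => q; rewrite -[in LHS]symPsi mxE.
Qed.

Section decay.
Variable lam : R.
Local Notation decay p := (expR (- lam * p.1)).

Lemma smooth_on_slab_decay m n (Psi : ST -> 'M[R]_(m, n)) :
  smooth_on_slab Psi -> smooth_on_slab (fun p => decay p *: Psi p).
Proof.
move=> [pPsi sPsi]; split; first by move=> t x i /=; rewrite pPsi.
move=> k; apply/cont_diff_mxP => i j; under eq_fun do rewrite mxE.
by apply: cont_diff_decay; exact: smooth_entry.
Qed.

Lemma derive_decay m n (Psi : ST -> 'M[R]_(m, n)) w p : smooth_on_slab Psi ->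
  'D_w (fun p => decay p *: Psi p) p =
  decay p *: ('D_w Psi p - (lam * w.1) *: Psi p).
Proof.
move=> sPsi; apply/matrixP => i j; rewrite derive_mxE; last first.
  by have [] := smooth_on_slab_decay sPsi.
have dPsi : derivable (fun p => Psi p i j) p w.
  by apply: smooth_derivable; apply: smooth_entry; case: sPsi.
under eq_fun do rewrite mxE.
rewrite !mxE derive_mxE; last by case: sPsi.
apply: derive_val; apply: (@is_derive_eq _ _ _ _ _ _ _ _
  (is_deriveM (is_derive_decay lam p w) (derivableP dPsi))).
by rewrite /GRing.scale /=; ring.
Qed.

End decay.

Lemma smooth_on_slab_div_op (Psi : ST -> 'M[R]_(d + 1)) :
  smooth_on_slab Psi -> smooth_on_slab (div_op Psi).
Proof.
move=> sPsi; split.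
  move=> t x i; apply/rowP => k; rewrite !mxE; congr (- _); apply: eq_bigr => j _.
  by rewrite /Dx periodic_derive//; case: sPsi.
move=> k; apply/cont_diff_mxP => i j.
rewrite (_ : (fun p => _) = fun p => -1 * (\sum_(l < d) Dx l Psi p j (lshift 1 l)) + 0).
  apply: cont_diff_lin.
    apply: cont_diff_sum => l; apply: smooth_entry.
    by case: (smooth_on_slab_derive (0, delta_mx 0 l) sPsi).
  exact: cont_diff_cst.
by apply/funext => p; rewrite mxE mulN1r addr0.
Qed.

(** Entrywise this is [derive_comm]. It is the source of the cancellation behind the linear
    constraint: [nu] is tested with [Dt Phi] and [mu] with [div_op Phi]. *)
Lemma Dt_div_op (Psi : ST -> 'M[R]_(d + 1)) p :
  smooth_on_slab Psi -> Dt (div_op Psi) p = div_op (Dt Psi) p.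
Proof.
move=> sPsi; have sP : smooth Psi by case: sPsi.
have sD := (smooth_on_slab_div_op sPsi).2.
apply/rowP => i; rewrite [in RHS]mxE /Dt derive_mxE//.
pose F j q := Psi q i (lshift 1 j).
have sF j : smooth (F j) by exact: smooth_entry.
pose e j : ST := (0, delta_mx 0 j).
have -> : (fun q => div_op Psi q 0 i) = - (\sum_(j < d) 'D_(e j) (F j)).
  apply/funext => q; rewrite mxE fctE; congr (- _); rewrite fct_sumE.
  by apply: eq_bigr => j _; rewrite /Dx derive_mxE.
have dF j q w : derivable ('D_(e j) (F j)) q w.
  exact/smooth_derivable/smooth_derive.
rewrite deriveN; last exact: derivable_sum.
rewrite derive_sum//; congr (- _); apply: eq_bigr => j _.
rewrite /Dx derive_mxE; last exact: smooth_derive.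
have -> : (fun q => 'D_(1, 0) Psi q i (lshift 1 j)) = 'D_(1, 0) (F j).
  by apply/funext => q; rewrite derive_mxE.
apply: derive_comm.
- by move=> q; exact: smooth_derivable.
- by move=> q; exact: smooth_derivable.
- by move=> q; exact/smooth_derivable/smooth_derive.
- by move=> q; exact/smooth_derivable/smooth_derive.
- by apply/smooth_continuous/smooth_derive/smooth_derive.
- by apply/smooth_continuous/smooth_derive/smooth_derive.
Qed.

Lemma div_op_decay lam (Psi : ST -> 'M[R]_(d + 1)) p : smooth_on_slab Psi ->
  div_op (fun p => expR (- lam * p.1) *: Psi p) p =
  expR (- lam * p.1) *: div_op Psi p.
Proof.
move=> sPsi; apply/rowP => i; rewrite !mxE mulrN mulr_sumr; congr (- _).
apply: eq_bigr => j _; rewrite /Dx derive_decay//= mulr0 scale0r subr0.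
by rewrite mxE.
Qed.

(** Only space derivatives occur, so the values at time 0 suffice. This makes [div_op Psi] a
    legitimate test function for [mu], which requires a zero initial value. *)
Lemma div_op_initial (Psi : ST -> 'M[R]_(d + 1)) x :
  (forall x, Psi (0, x) = 0) -> div_op Psi (0, x) = 0.
Proof.
move=> Psi0; apply/rowP => i; rewrite !mxE big1 ?oppr0// => j _.
rewrite /Dx derive_line.
rewrite (_ : (fun h => _) = cst 0); first by rewrite derive_cst mxE.
apply/funext => h; rewrite /cst -(Psi0 (h *: delta_mx 0 j + x)); congr Psi.
by congr pair; rewrite /= scaler0 addr0.
Qed.

End test_functions.

(** * Positive semidefinite matrices *)

Section psd_theory.
Context {R : realType}.

Lemma quadratic_formE n (A : 'M[R]_n) (x : 'rV[R]_n) :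
  (x *m A *m x^T) 0 0 = \sum_i \sum_j A i j * (x 0 i * x 0 j).
Proof.
rewrite mxE exchange_big /=; apply: eq_bigr => j _.
rewrite !mxE mulr_suml; apply: eq_bigr => i _; rewrite mulrAC; ring.
Qed.

Lemma psdP n (A : 'M[R]_n) : psd A <-> (forall i j, A i j = A j i) /\
  forall x : 'I_n -> R, 0 <= \sum_i \sum_j A i j * (x i * x j).
Proof.
split=> [[sA pA]|[sA pA]].
  split=> [i j|x]; first by rewrite -[in LHS]sA mxE.
  have := pA (\row_i x i); rewrite quadratic_formE.
  by under eq_bigr do under eq_bigr do rewrite !mxE.
split; first by apply/matrixP => i j; rewrite mxE sA.
by move=> x; rewrite quadratic_formE; exact: (pA (x 0)).
Qed.

Let quad_lin n (A : 'I_n -> 'I_n -> R) (x y : 'I_n -> R) t :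
  (forall i j, A i j = A j i) ->
  \sum_i \sum_j A i j * ((x i + t * y i) * (x j + t * y j)) =
  \sum_i \sum_j A i j * (x i * x j) + 2 * t * (\sum_i \sum_j A i j * (x i * y j))
  + t ^+ 2 * \sum_i \sum_j A i j * (y i * y j).
Proof.
move=> sA.
have sw : \sum_i \sum_j A i j * (y i * x j) = \sum_i \sum_j A i j * (x i * y j).
  rewrite exchange_big /=; apply: eq_bigr => i _; apply: eq_bigr => j _.
  by rewrite sA; ring.
transitivity (\sum_i \sum_j A i j * (x i * x j) + t * (\sum_i \sum_j A i j * (y i * x j))
  + t * (\sum_i \sum_j A i j * (x i * y j)) + t ^+ 2 * \sum_i \sum_j A i j * (y i * y j)).
  rewrite !mulr_sumr -!big_split; apply: eq_bigr => i _ /=.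
  by rewrite !mulr_sumr -!big_split; apply: eq_bigr => j _ /=; ring.
by rewrite sw; ring.
Qed.

Let sum_delta n (i0 : 'I_n) (F : 'I_n -> R) : \sum_i (i == i0)%:R * F i = F i0.
Proof.
rewrite (bigD1 i0)//= eqxx mul1r big1 ?addr0// => i /negbTE ->.
by rewrite mul0r.
Qed.

(* One step of the Cholesky decomposition writes [A] as a rank one matrix plus a
   positive semidefinite matrix with zero first row and column. *)
Lemma psd_frobenius_ge0 n (A B : 'M[R]_n) : psd A -> psd B ->
  0 <= \sum_i \sum_j A i j * B i j.
Proof.
elim: n A B => [|n IHn] A B /psdP[sA pA] /psdP[sB pB]; first by rewrite big_ord0.
pose a := A 0 0.
have col x : \sum_i \sum_j A i j * (x i * (j == 0)%:R) = \sum_i A i 0 * x i.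
  apply: eq_bigr => i _.
  under eq_bigr do rewrite mulrA mulrC; exact: (sum_delta 0 (fun j => A i j * x i)).
have aa : \sum_i \sum_j A i j * ((i == 0)%:R * (j == 0)%:R) = a.
  rewrite col; under eq_bigr do rewrite mulrC; exact: (sum_delta 0 (fun i => A i 0)).
have quad x t : 0 <= \sum_i \sum_j A i j * (x i * x j) +
    2 * t * (\sum_i A i 0 * x i) + t ^+ 2 * a.
  have := pA (fun i => x i + t * (i == 0)%:R).
  by rewrite (quad_lin x (fun i => (i == 0)%:R))// aa col.
have a0 : 0 <= a by have := pA (fun i => (i == 0)%:R); rewrite aa.
have zero_col : a = 0 -> forall i, A i 0 = 0.
  move=> az i; pose b := A i 0.
  (* With [a = 0] the form is affine in [t], and this [t] gives it the value [-1] unless [b = 0]. *)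
  have := quad (fun j => (j == i)%:R) (- (A i i + 1) / (2 * b)).
  rewrite az mulr0 addr0.
  under eq_bigr => k _.
    under eq_bigr do rewrite mulrA mulrC.
    rewrite (sum_delta i (fun j => A k j * (k == i)%:R)) mulrC.
    over.
  rewrite (sum_delta i (fun k => A k i)).
  under eq_bigr do rewrite mulrC.
  rewrite (sum_delta i (fun k => A k 0)) -/b.
  have [//|b0] := eqVneq b 0.
  suff -> : 2 * (- (A i i + 1) / (2 * b)) * b = - (A i i + 1) by lra.
  by field.
(* Schur complement of the corner [a]. If [a = 0], the convention [0^-1 = 0] leaves [S = A], whose
   first column vanishes by [zero_col]. *)
pose S i j := A i j - a^-1 * (A i 0 * A j 0).
have S0 i : S i 0 = 0.
  rewrite /S; have [az|an0] := eqVneq a 0; first by rewrite !(zero_col az) !mul0r mulr0 subr0.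
  by rewrite -/a; field.
have sS i j : S i j = S j i by rewrite /S sA [A i 0 * _]mulrC.
have AS : \sum_i \sum_j A i j * B i j = \sum_i \sum_j S i j * B i j +
    a^-1 * \sum_i \sum_j B i j * (A i 0 * A j 0).
  rewrite mulr_sumr -big_split; apply: eq_bigr => i _ /=.
  by rewrite mulr_sumr -big_split; apply: eq_bigr => j _ /=; rewrite /S; ring.
rewrite AS addr_ge0//; last by rewrite mulr_ge0 ?invr_ge0//; exact: (pB (fun i => A i 0)).
rewrite big_ord_recl big1 ?add0r; last by move=> j _; rewrite sS S0 mul0r.
under eq_bigr do rewrite big_ord_recl S0 mul0r add0r.
pose S' := \matrix_(i, j) S (lift 0 i) (lift 0 j).
pose B' := \matrix_(i, j) B (lift 0 i) (lift 0 j).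
have pS' : psd S'.
  apply/psdP; split=> [i j|x]; first by rewrite !mxE sS.
  under eq_bigr do under eq_bigr do rewrite mxE.
  pose y i := oapp x 0 (unlift ord0 i).
  have -> : \sum_i \sum_j S (lift 0 i) (lift 0 j) * (x i * x j) =
      \sum_i \sum_j S i j * (y i * y j).
    rewrite [RHS]big_ord_recl [X in _ = X + _]big1 ?add0r; last by move=> j _; rewrite sS S0 mul0r.
    apply: eq_bigr => i _; rewrite big_ord_recl S0 mul0r add0r.
    by apply: eq_bigr => j _; rewrite /y !liftK.
  have -> : \sum_i \sum_j S i j * (y i * y j) =
      \sum_i \sum_j A i j * (y i * y j) - a^-1 * (\sum_i A i 0 * y i) ^+ 2.
    rewrite expr2 big_distrlr mulr_sumr -sumrB; apply: eq_bigr => i _ /=.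
    by rewrite mulr_sumr -sumrB; apply: eq_bigr => j _ /=; rewrite /S; ring.
  have [az|an0] := eqVneq a 0; first by rewrite az invr0 mul0r subr0.
  (* The minimizer in [t]; the minimum is the quadratic form of [S] at [y]. *)
  have := quad y (- a^-1 * \sum_i A i 0 * y i).
  by congr (0 <= _); field.
have pB' : psd B'.
  apply/psdP; split=> [i j|x]; first by rewrite !mxE sB.
  under eq_bigr do under eq_bigr do rewrite mxE.
  pose y i := oapp x 0 (unlift ord0 i).
  have := pB y; congr (0 <= _).
  rewrite big_ord_recl big1 ?add0r; last by move=> j _; rewrite /y unlift_none mul0r mulr0.
  apply: eq_bigr => i _; rewrite big_ord_recl {2}/y unlift_none !mulr0 add0r.
  by apply: eq_bigr => j _; rewrite /y !liftK.
apply: le_trans (IHn S' B' pS' pB') _; apply: ler_sum => i _; apply: ler_sum => j _.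
by rewrite !mxE.
Qed.

End psd_theory.

(** * The flux *)

(** The case [y = 0] is included because a subsolution may reach vacuum. Convexity bounds the
    difference quotients along the segment from [r] to [y] by [g y - g r], so their limit cannot
    exceed it. *)
Lemma convex_tangent_le {R : realType} (g : R -> R) (r y : R) :
  convex_function (`[0, +oo[%classic : set R) g -> 0 < r -> 0 <= y ->
  derivable g r 1 -> g r + derive1 g r * (y - r) <= g y.
Proof.
move=> cg r0 y0 dg.
pose k (t : R) := g (t * (y - r) + r).
have dk : is_derive (0 : R) 1 k (derive1 g r * (y - r)).
  apply: (@is_derive1_comp _ g (fun t : R => t * (y - r) + r)).
    rewrite mul0r add0r derive1E; exact: derivableP.
  by apply: is_derive_eq; rewrite scaler0 add0r addr0 [_ *: _]mulr1.
have chord t : 0 <= t <= 1 -> k t <= g r + t * (g y - g r).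
  move=> /andP[t0 t1].
  pose t' : {i01 R} := Itv01 t0 t1.
  have cgt : g (t * y + (1 - t) * r) <= t * g y + (1 - t) * g r.
    by apply: (cg t'); rewrite inE /= in_itv /= ?y0 ?(ltW r0).
  rewrite /k (_ : t * (y - r) + r = t * y + (1 - t) * r); last by ring.
  by apply: (le_trans cgt); lra.
rewrite -lerBrDl leNgt; apply/negP => lt.
have [_ Dk] := dk.
have : (fun h : R => h^-1 *: ((k \o shift 0) (h *: 1) - k 0)) @ 0^' --> derive1 g r * (y - r).
  by rewrite -Dk; case: dk.
move/cvgrPdist_lt => /(_ (derive1 g r * (y - r) - (g y - g r))).
rewrite subr_gt0 => /(_ lt)[e /= e0 He].
pose t := Num.min (e / 2) 1.
have t0 : 0 < t by rewrite lt_min ltr01 divr_gt0.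
have te : t < e by rewrite gt_min ltr_pdivrMr// ltr_pMr// ltr1n.
have := He t; rewrite /ball_ /= sub0r normrN gtr0_norm// => /(_ te (lt0r_neq0 t0)).
have := chord t; rewrite (ltW t0) ge_min lexx orbT => /(_ isT).
have k0 : k 0 = g r by rewrite /k mul0r add0r.
rewrite addr0 [t *: 1]mulr1 k0 => kt.
have : t^-1 *: (k t - g r) <= g y - g r.
  by rewrite [_ *: _]mulrC ler_pdivrMr// mulrC lerBlDl.
move: (t^-1 *: _) => z zle; rewrite ltr_norml => /andP[_]; lra.
Qed.

Section flux_calculus.
Context {R : realType} (d : nat) (P U : R -> R) (PU : pressure_law d P U).
Local Notation N := (d + 1)%N.
Local Notation last := (rshift d ord0 : 'I_N).
Implicit Types (v w : 'rV[R]_N) (i j l : 'I_N).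

Lemma densityE v : density v = v 0 last.
Proof. by rewrite /density mxE. Qed.

Definition flux_diag i (y : R) : R :=
  if fintype.split i is inl _ then P y else 2 * U y - d%:R * P y - y.

Definition flux_diag' i (y : R) : R :=
  if fintype.split i is inl _ then derive1 P y
  else 2 * derive1 U y - d%:R * derive1 P y - 1.

Lemma derivable_energy (y : R) : 0 < y -> derivable U y 1.
Proof. by move=> y0; exact: (@energy_smooth _ _ _ _ PU 0%N y y0). Qed.

(** Smoothness is assumed of [U]; that of [P] comes from [P = U' y - U + U 0], where the terms in
    [U'] cancel on differentiation. *)
Lemma is_derive_pressure (y : R) : 0 < y -> is_derive y 1 P (derive1n 2 U y * y).
Proof.
move=> y0.
have D : is_derive y 1 (fun y => derive1 U y * y - U y + U 0)
    (derive1n 2 U y * y).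
  have d2 : is_derive y 1 (derive1 U) (derive1n 2 U y).
    rewrite [derive1n 2 U y]derive1E; apply: derivableP.
    exact: (@energy_smooth _ _ _ _ PU 1%N y y0).
  have d1 : is_derive y 1 U (derive1 U y).
    by rewrite derive1E; apply: derivableP; exact: derivable_energy.
  by apply: is_derive_eq; rewrite /GRing.scale /=; ring.
apply: near_eq_is_derive D; near=> z; rewrite (pressureE PU)//.
by near: z; exact: lt_nbhsr.
Unshelve. all: by end_near. Qed.

Lemma is_derive_flux_diag i (y : R) : 0 < y -> is_derive y 1 (flux_diag i) (flux_diag' i y).
Proof.
move=> y0; have dP := is_derive_pressure y0.
have dP' : is_derive y 1 P (derive1 P y) by rewrite derive1E; apply: derivableP.
have dU' : is_derive y 1 U (derive1 U y).
  by rewrite derive1E; apply: derivableP; exact: derivable_energy.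
rewrite /flux_diag /flux_diag'; case: fintype.split => _ //.
by apply: is_derive_eq; rewrite /GRing.scale /=; ring.
Qed.

Lemma flux_diag_tangent i (r y : R) : 0 < r -> 0 <= y ->
  flux_diag i r + flux_diag' i r * (y - r) <= flux_diag i y.
Proof.
move=> r0 y0; have dP := is_derive_pressure r0.
have dU := derivable_energy r0.
rewrite /flux_diag /flux_diag'; case: fintype.split => _.
  by apply: convex_tangent_le => //; exact: (pressure_convex PU).
have dP' : is_derive r 1 P (derive1 P r) by rewrite derive1E; apply: derivableP.
have dU' : is_derive r 1 U (derive1 U r) by rewrite derive1E; apply: derivableP.
have D : is_derive r 1 (fun y => 2 * U y - d%:R * P y) (2 * derive1 U r - d%:R * derive1 P r).
  by apply: is_derive_eq; rewrite /GRing.scale /=; ring.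
have := convex_tangent_le (energy_pressure_convex PU) r0 y0.
rewrite [derive1 (fun y => 2 * U y - _) r]derive1E; case: D => D ->; move=> /(_ D).
lra.
Qed.

Lemma fluxE v i j : 0 < density v -> flux P U v i j =
  (density v)^-1 * (v 0 i * v 0 j) + (i == j)%:R * flux_diag i (density v).
Proof.
move=> v0; rewrite /flux v0 /flux_diag.
rewrite mxE; congr (_ + _); first by rewrite mxE mxE big_ord1 mxE.
rewrite mxE; case: (split_ordP i) => i' ->; rewrite mxE; case: (split_ordP j) => j' ->.
- by rewrite !mxE eq_lshift mulr_natl.
- by rewrite mxE eq_lrshift mul0r.
- by rewrite mxE eq_rlshift mul0r.
- by rewrite !mxE eq_rshift [RHS]mulr_natl.
Qed.

(** Here [z] is the velocity completed by a last component 1, or zero at vacuum. In terms of density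
    and [z] the flux contains no division, so both parts of the domain are treated at once. *)
Lemma flux_domE w : dom_flux w -> exists z : 'I_N -> R,
  [/\ 0 <= density w, forall i, w 0 i = density w * z i &
  forall i j, flux P U w i j =
    density w * (z i * z j) + (i == j)%:R * flux_diag i (density w)].
Proof.
case=> [w0|->].
  exists (fun i => w 0 i / density w); split; first exact: ltW.
    by move=> i; rewrite mulrC divfK ?gt_eqF.
  move=> i j; rewrite fluxE//; congr (_ + _); field.
  by rewrite gt_eqF.
have d0 : density (0 : 'rV[R]_N) = 0 by rewrite densityE mxE.
exists (fun=> 0); rewrite d0; split=> //; first by move=> i; rewrite mxE mul0r.
move=> i j; rewrite mul0r add0r /flux d0 ltxx /flux_diag.
rewrite mxE; case: (split_ordP i) => i' ->; rewrite mxE; case: (split_ordP j) => j' ->.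
- by rewrite mxE (pressure_0 PU) mulr0.
- by rewrite mxE eq_lrshift mul0r.
- by rewrite mxE eq_rlshift mul0r.
- by rewrite !mxE eq_rshift (pressure_0 PU) mulr0 !subr0 [RHS]mulr_natl.
Qed.

(** The quotient rule for [v_i v_j / rho], where [rho] is itself the last component of [v], plus the
    derivative of the diagonal part. *)
Definition flux_deriv v l i j : R :=
  (density v)^-1 * ((l == i)%:R * v 0 j + (l == j)%:R * v 0 i)
  - (l == last)%:R * ((density v)^-1 ^+ 2 * (v 0 i * v 0 j))
  + (i == j)%:R * ((l == last)%:R * flux_diag' i (density v)).

Lemma is_derive_coord v w i : is_derive v w (fun v : 'rV[R]_N => v 0 i) (w 0 i).
Proof.
have did := @derivable_id _ _ v w.
apply: DeriveDef; first exact: (derivable_mxP _ _ _).1 did 0 i.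
by have /matrixP/(_ 0 i) := derive_mx did; rewrite derive_id mxE.
Qed.

Lemma is_derive_flux v l i j : 0 < density v ->
  is_derive v (delta_mx 0 l) (fun v => flux P U v i j) (flux_deriv v l i j).
Proof.
move=> v0; have vl : 0 < v 0 last by rewrite -densityE.
have dc k := is_derive_coord v (delta_mx 0 l) k.
have dd : is_derive v (delta_mx 0 l) (fun w : 'rV[R]_N => flux_diag i (w 0 last))
    (flux_diag' i (v 0 last) * (delta_mx 0 l : 'rV[R]_N) 0 last).
  exact: (is_derive_comp_real (dc last) (is_derive_flux_diag i vl)).
have dinv : is_derive v (delta_mx 0 l) (fun w : 'rV[R]_N => (w 0 last)^-1)
    (- (v 0 last) ^- 2 *: (delta_mx 0 l : 'rV[R]_N) 0 last).
  have [dl <-] := dc last; have n0 : v 0 last != 0 by rewrite gt_eqF.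
  by apply: DeriveDef; [exact: derivableV | rewrite deriveV].
have D : is_derive v (delta_mx 0 l)
    (fun w : 'rV[R]_N => (w 0 last)^-1 * (w 0 i * w 0 j) +
       (i == j)%:R * flux_diag i (w 0 last)) (flux_deriv v l i j).
  have di := dc i; have dj := dc j.
  apply: is_derive_eq.
  rewrite /flux_deriv densityE !mxE /= /GRing.scale /= ![_ == l]eq_sym.
  by rewrite exprVn; ring.
have c : w 0 last @[w --> v] --> v 0 last by exact: coord_continuous.
apply: near_eq_is_derive D; near=> w; rewrite fluxE ?densityE//.
by near: w; exact: (cvgr_gt _ c).
Unshelve. all: by end_near. Qed.

Lemma derivable_flux v l : 0 < density v -> derivable (flux P U) v (delta_mx 0 l).
Proof. by move=> v0; apply/derivable_mxP => i j; case: (is_derive_flux l i j v0). Qed.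

Lemma DfluxE v l i j : 0 < density v -> Dflux P U l v i j = flux_deriv v l i j.
Proof.
move=> v0; rewrite /Dflux derive_mx ?mxE; last exact: derivable_flux.
by case: (is_derive_flux l i j v0).
Qed.

Lemma entropy_gradE v l : 0 < density v ->
  entropy_grad P U v 0 l = 2^-1 * \sum_i Dflux P U l v i i.
Proof.
move=> v0; rewrite mxE.
have D : is_derive v (delta_mx 0 l)
    (fun w => 2^-1 * (\sum_i (fun w => flux P U w i i)) w)
    (2^-1 * \sum_i flux_deriv v l i i).
  apply: is_deriveZ; apply: is_derive_sum => i; exact: is_derive_flux.
have -> : entropy P U = fun w => 2^-1 * (\sum_i (fun w => flux P U w i i)) w.
  by apply/funext => w; rewrite /entropy /mxtrace fct_sumE.
by case: D => _ ->; congr (_ * _); apply: eq_bigr => i _; rewrite DfluxE.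
Qed.

(** The kinetic part is a perspective function: its first-order remainder is exactly the density of
    [w] times the square of the velocity difference [z - u], a rank one matrix. The diagonal
    remainder is a tangent gap, nonnegative by convexity of [P] and of [2 U - d P]. *)
Lemma flux_convex v w : 0 < density v -> dom_flux w ->
  exists (r : R) (z c : 'I_N -> R), [/\ 0 <= r, forall i, 0 <= c i &
  forall i j, flux P U w i j - flux P U v i j
      - \sum_l (w 0 l - v 0 l) * Dflux P U l v i j =
    r * (z i * z j) + (i == j)%:R * c i].
Proof.
move=> v0 /flux_domE[z [w0 wz Fw]]; pose u i := v 0 i / density v.
have vn0 : density v != 0 by rewrite gt_eqF.
exists (density w), (fun i => z i - u i), (fun i => flux_diag i (density w)
  - (flux_diag i (density v) + flux_diag' i (density v) * (density w - density v))).
split=> // [i|i j]; first by rewrite subr_ge0; exact: flux_diag_tangent.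
rewrite Fw fluxE//.
under eq_bigr do rewrite DfluxE// /flux_deriv.
have sum_l (k : 'I_N) (F : 'I_N -> R) : \sum_l (l == k)%:R * F l = F k.
  rewrite (bigD1 k)//= eqxx mul1r big1 ?addr0// => l /negbTE ->.
  by rewrite mul0r.
pose D l := w 0 l - v 0 l.
have -> : \sum_l (w 0 l - v 0 l) * ((density v)^-1 * ((l == i)%:R * v 0 j
       + (l == j)%:R * v 0 i) - (l == last)%:R * ((density v)^-1 ^+ 2
       * (v 0 i * v 0 j)) + (i == j)%:R * ((l == last)%:R * flux_diag' i (density v))) =
    \sum_l (l == i)%:R * (D l * ((density v)^-1 * v 0 j)) +
    \sum_l (l == j)%:R * (D l * ((density v)^-1 * v 0 i)) +
    \sum_l (l == last)%:R * (D l * ((i == j)%:R * flux_diag' i (density v) -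
      (density v)^-1 ^+ 2 * (v 0 i * v 0 j))).
  rewrite -!big_split; apply: eq_bigr => l _ /=; rewrite /D; ring.
rewrite !sum_l /D -!densityE (wz i) (wz j) /u.
by field.
Qed.

Lemma flux_excess_psd v w (M : 'M[R]_N) : 0 < density v -> dom_flux w ->
  psd (M - flux P U w) ->
  psd (\matrix_(i, j) (M i j - flux P U v i j
    - \sum_l (w 0 l - v 0 l) * Dflux P U l v i j)).
Proof.
move=> v0 dw /psdP[sMF pMF].
have [r [z [c [r0 c0 E]]]] := flux_convex v0 dw.
have E' i j : M i j - flux P U v i j - \sum_l (w 0 l - v 0 l) * Dflux P U l v i j =
    (M - flux P U w) i j + (r * (z i * z j) + (i == j)%:R * c i).
  by rewrite -E !mxE; ring.
apply/psdP; split=> [i j|x].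
  rewrite !mxE !E' sMF [z i * z j]mulrC; congr (_ + (_ + _)).
  by have [->//|_] := eqVneq i j; rewrite !mul0r.
under eq_bigr do under eq_bigr do rewrite mxE E' mulrDl.
under eq_bigr do rewrite big_split.
rewrite big_split addr_ge0//=.
have -> : \sum_i \sum_j (r * (z i * z j) + (i == j)%:R * c i) * (x i * x j) =
    r * (\sum_i z i * x i) ^+ 2 + \sum_i c i * x i ^+ 2.
  rewrite expr2 big_distrlr mulr_sumr -big_split; apply: eq_bigr => i _ /=.
  have -> : c i * x i ^+ 2 = \sum_j (i == j)%:R * c i * (x i * x j).
    rewrite (bigD1 i)//= eqxx mul1r big1 ?addr0 ?expr2// => j.
    by rewrite eq_sym => /negbTE ->; rewrite !mul0r.
  by rewrite mulr_sumr -big_split; apply: eq_bigr => j _ /=; ring.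
apply: addr_ge0; first by rewrite mulr_ge0 ?sqr_ge0.
by apply: sumr_ge0 => i _; apply: mulr_ge0 => //; exact: sqr_ge0.
Qed.

(** In the trace the [d] pressures cancel against [- d P], and the last kinetic entry [r^2 / r]
    against [- r]. *)
Lemma entropy_state (q : 'rV[R]_d) (r : R) : 0 < r ->
  entropy P U (state q r) = (\sum_(i < d) q 0 i ^+ 2) / (2 * r) + U r.
Proof.
move=> r0; have dr : density (state q r) = r.
  by rewrite /density /state row_mxKr mxE eqxx.
have rn0 : r != 0 by rewrite gt_eqF.
rewrite /entropy /mxtrace; under eq_bigr do rewrite fluxE ?dr// eqxx mul1r.
rewrite big_split_ord big_ord1 /= /state row_mxEr mxE eqxx /flux_diag.
rewrite (unsplitK (inr _ : 'I_d + 'I_1)).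
under eq_bigr do rewrite row_mxEl (unsplitK (inl _ : 'I_d + 'I_1)).
rewrite big_split /= sumr_const card_ord -[P r *+ d]mulr_natl -mulr_sumr.
have -> : \sum_(i < d) q 0 i ^+ 2 = \sum_(i < d) q 0 i * q 0 i by [].
by rewrite mulr1n; field.
Qed.

End flux_calculus.

(** * Charges with a density, and identities tested with functions *)

Section density_charges.
Context dX (X : measurableType dX) (R : realType) (D : set X).
Hypothesis mD : measurable D.
Implicit Types (I : set X -> (X -> R) -> R) (f g : X -> R).

(** Made for condition (iv), which is known on sets and needed against a function. The two isolated
    terms become the indices [None] and [Some None] of one family. *)
Lemma signed_integral_balance (J : finType) I0 I1
    (I : J -> set X -> (X -> R) -> R) f0 f1 (f : J -> X -> R) g :
  signed_integral D I0 -> signed_integral D I1 ->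
  (forall j, signed_integral D (I j)) ->
  bounded_measurable D f0 -> bounded_measurable D f1 ->
  (forall j, bounded_measurable D (f j)) -> bounded_measurable D g ->
  (forall A, measurable A -> A `<=` D ->
    I0 A f0 + I1 A f1 + \sum_j I j A (f j) = 0) ->
  I0 D (fun x => g x * f0 x) + I1 D (fun x => g x * f1 x)
  + \sum_j I j D (fun x => g x * f j x) = 0.
Proof.
move=> sI0 sI1 sI bf0 bf1 bf bg bal.
pose I' (o : option (option J)) := oapp (oapp I I1) I0 o.
pose f' (o : option (option J)) := oapp (oapp f f1) f0 o.
have big_o (K : finType) (F : option K -> R) :
    \sum_o F o = F None + \sum_j F (Some j).
  rewrite (bigD1 None)//=; congr (_ + _).
  rewrite (reindex_omap Some id) => [|[]//].
  by apply: eq_bigl => j /=; rewrite eqxx.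
have := @signed_integral_pairing_eq0 _ _ _ _ _ I' f' g mD.
rewrite !big_o /= addrA; apply=> //.
- by case=> [[j|]|]; [exact: sI | exact: sI1 | exact: sI0].
- by case=> [[j|]|]; [exact: bf | exact: bf1 | exact: bf0].
- by move=> A mA AD; rewrite !big_o /= addrA; exact: bal.
Qed.

Let sum_unit (F : unit -> R) : \sum_j F j = F tt.
Proof. by rewrite (big_pred1 tt)//; case. Qed.

Lemma charge_density I f : signed_integral D I -> bounded_measurable D f ->
  exists E : {charge set X -> \bar R},
    (forall A, measurable A -> A `<=` D -> E A = (I A f)%:E) /\
    forall g, bounded_measurable D g ->
      charge_integral E D g = I D (fun x => g x * f x).
Proof.
move=> sI bf; have [E EE] := signed_integral_charge mD sI bf.
exists E; split=> // g bg.
have := @charge_integralE _ _ _ _ mD unit (fun=> I) (fun=> f) E g.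
rewrite sum_unit; apply=> // A mA AD.
by rewrite EE// sum_unit.
Qed.

Lemma charge_density2 I1 I2 f1 f2 :
  signed_integral D I1 -> signed_integral D I2 ->
  bounded_measurable D f1 -> bounded_measurable D f2 ->
  exists E : {charge set X -> \bar R}, forall g, bounded_measurable D g ->
    charge_integral E D g = I1 D (fun x => g x * f1 x) + I2 D (fun x => g x * f2 x).
Proof.
move=> sI1 sI2 bf1 bf2.
pose I (b : bool) := if b then I1 else I2.
pose f (b : bool) := if b then f1 else f2.
have sI b : signed_integral D (I b) by case: b.
have bf b : bounded_measurable D (f b) by case: b.
have [E EE] := signed_integral_charge_sum mD (index_enum bool) sI bf.
exists E => g bg.
have sum_bool (F : bool -> R) : \sum_b F b = F true + F false.
  by rewrite (bigD1 true)//= (big_pred1 false)//; case.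
by rewrite (charge_integralE mD sI bf _ bg) ?sum_bool// => A mA AD; rewrite EE.
Qed.

(** The Hahn sets of [m1] and [m2] may be unrelated, so the equality goes through [charge_integralE]
    with density 1. It transfers the symmetry of [nu] to its damped version. *)
Lemma eq_charge_integral (m1 m2 : {charge set X -> \bar R}) g :
  (forall A, measurable A -> A `<=` D -> m1 A = m2 A) ->
  bounded_measurable D g -> charge_integral m1 D g = charge_integral m2 D g.
Proof.
move=> m12 bg.
have s2 := signed_charge_integral D m2.
have := @charge_integralE _ _ _ _ mD unit (fun=> charge_integral m2) (fun=> cst 1) m1 g.
rewrite sum_unit.
move=> -> //.
- by congr charge_integral; apply/funext => x; rewrite mulr1.
- by move=> _; exact: bounded_measurable_cst.
- move=> A mA AD; rewrite sum_unit.
  by rewrite charge_integral_cst1// m12.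
Qed.

End density_charges.

(** * Relative entropy of a subsolution *)

Section slab_functions.
Context {R : realType} (d : nat) (T : R).
Local Notation ST := (R * 'rV[R]_d)%type.
Local Notation X := (@measurable_spacetime R d).
Local Notation D := (cell T : set X).

Lemma within_entry m n (A : set ST) (f : ST -> 'M[R]_(m, n)) i j :
  {within A, continuous f} -> {within A, continuous (fun p => f p i j)}.
Proof.
move=> cf p.
exact: (@continuous_comp _ _ _ (f : subspace A -> _)
  (fun M : 'M[R]_(m, n) => M i j) p (cf p) (@coord_continuous _ _ _ i j (f p))).
Qed.

Lemma slab_bounded_measurable_mx m n (f : ST -> 'M[R]_(m, n)) i j :
  {within slab T, continuous f} -> bounded_measurable D (fun p => f p i j).
Proof. by move=> cf; apply: slab_bounded_measurable; exact: within_entry. Qed.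

Lemma bounded_measurable_continuous (f : ST -> R) :
  continuous f -> bounded_measurable D f.
Proof. by move=> cf; exact/slab_bounded_measurable/continuous_subspaceT. Qed.

Lemma bounded_measurable_decay lam :
  bounded_measurable D (fun p => expR (- lam * p.1)).
Proof.
apply: bounded_measurable_continuous => p.
apply: (@continuous_comp _ _ _ (fun p : ST => - lam * p.1) expR).
  by apply: cvgM; [exact: cvg_cst | exact: cvg_fst].
exact: continuous_expR.
Qed.

Lemma slab_bounded_measurable_comp (r : ST -> R) (k : R -> R) :
  {within slab T, continuous r} -> (forall p, slab T p -> 0 < r p) ->
  (forall y, 0 < y -> {for y, continuous k}) ->
  bounded_measurable D (fun p => k (r p)).
Proof.
move=> cr r0 ck; apply: slab_bounded_measurable; apply/subspace_continuousP => p sp.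
have := (subspace_continuousP _ _).1 cr p sp => rp.
exact: (cvg_comp _ _ rp (ck _ (r0 p sp))).
Qed.

Lemma cell_slab (p : ST) : cell T p -> slab T p. Proof. by case. Qed.

Lemma slabP (p : ST) : slab T p -> 0 <= p.1 <= T.
Proof. by case=> /=; rewrite in_itv. Qed.

Lemma bounded_measurable_smooth m n (Psi : ST -> 'M[R]_(m, n)) i j :
  smooth_on_slab Psi -> bounded_measurable D (fun p => Psi p i j).
Proof.
move=> [_ sPsi]; apply: bounded_measurable_continuous.
exact/smooth_continuous/smooth_entry.
Qed.

Lemma signed_leb : signed_integral D (Rintegral (leb_spacetime d)).
Proof. by apply: signed_Rintegral; [exact: measurable_cell | exact: leb_cell_lty]. Qed.

End slab_functions.

Section weight_tail_theory.
Context {R : realType} (T : R) (h : R -> R) (hw : weight T h) (T0 : 0 < T).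
Local Notation mu := (@lebesgue_measure R).
Local Notation H := (weight_tail T h).

Lemma weight_continuous : continuous h.
Proof. exact: (smooth_continuous (weight_smooth hw)). Qed.

Lemma weight_ge0 t : 0 <= t <= T -> 0 <= h t.
Proof.
move=> tT; have [a [b [a0 /(_ t tT)/andP[ha _]]]] := weight_bounds hw.
exact: le_trans (ltW a0) ha.
Qed.

Let integrable_weight s t : mu.-integrable `[s, t]%classic (EFin \o h).
Proof.
apply: continuous_compact_integrable; first exact: segment_compact.
exact/continuous_subspaceT/weight_continuous.
Qed.

Lemma weight_tail_ge a : 0 <= a -> (forall t, 0 <= t <= T -> a <= h t) ->
  forall t, 0 <= t <= T -> a * (T - t) <= H t.
Proof.
move=> a0 ah t /andP[t0 tT].
have -> : a * (T - t) = \int[mu]_(s in `[t, T]) a.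
  rewrite Rintegral_cst//; congr (_ * _).
  have := @lebesgue_measure_itv R `[t, T]; rewrite /= lte_fin => E.
  rewrite [X in fine X]E; case: ltrP => [_|Tt]; first by rewrite -EFinB.
  by rewrite (@le_anti _ _ T t) ?Tt ?tT// subrr.
apply: le_Rintegral => //.
  apply: continuous_compact_integrable; first exact: segment_compact.
  by apply: continuous_subspaceT => x; exact: cvg_cst.
move=> s /=; rewrite in_itv /= => /andP[ts sT]; apply: ah.
by rewrite sT (le_trans t0).
Qed.

Lemma weight_tail_nincr s t : 0 <= s -> s <= t -> t <= T -> H t <= H s.
Proof.
move=> s0 st tT.
have : \int[mu]_(r in `[s, T]) h r - \int[mu]_(r in `[s, t]) h r = \int[mu]_(r in `]t, T]) h r.
  by rewrite Rintegral_itvB//= bnd_simp.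
rewrite Rintegral_itv_obnd_cbnd; last first.
  by apply: integrableS (integrable_weight t T) => //; exact: subset_itv_oc_cc.
rewrite -/(H s) -/(H t) => <-; rewrite gerBl Rintegral_ge0// => r /=.
rewrite in_itv /= => /andP[sr rt]; apply: weight_ge0.
by rewrite (le_trans s0 sr) (le_trans rt tT).
Qed.

Lemma bounded_measurable_weight :
  bounded_measurable (`[0, T]%classic : set (measurableTypeR R)) h.
Proof.
split.
  have mh := continuous_measurable_fun weight_continuous.
  by apply: measurable_funTS; exact: mh.
have [a [b [_ hb]]] := weight_bounds hw; exists b => t; rewrite /= in_itv /= => tT.
by rewrite ger0_norm ?weight_ge0//; have /andP[] := hb t tT.
Qed.

Lemma bounded_measurable_weight_tail :
  bounded_measurable (`[0, T]%classic : set (measurableTypeR R)) H.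
Proof.
split.
  (* The tail is known to be monotone on [[0, T]]; clamping the time yields a nonincreasing, hence
     measurable, function on the whole line. *)
  pose clamp t := Num.max 0 (Num.min t T).
  apply: (@eq_measurable_fun _ _ _ _ _ (H \o clamp)).
    move=> t; rewrite inE /= in_itv /= => /andP[t0 tT].
    by rewrite /clamp (min_idPl tT) (max_idPr t0).
  apply: nonincreasing_measurable => // s t st.
  apply: weight_tail_nincr; first by rewrite le_max lexx.
    by rewrite /clamp ge_max !le_max !le_min !ge_min !lexx st !orbT.
  by rewrite /clamp ge_max (ltW T0) ge_min lexx orbT.
exists (H 0) => t /=; rewrite in_itv /= => /andP[t0 tT].
rewrite ger0_norm ?weight_tail_nincr//; apply: Rintegral_ge0 => r /=.
rewrite in_itv /= => /andP[tr rT].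
by apply: weight_ge0; rewrite rT (le_trans t0 tr).
Qed.

End weight_tail_theory.

Lemma bounded_measurable_time {R : realType} d (T : R) (k : R -> R) :
  bounded_measurable (`[0, T]%classic : set (measurableTypeR R)) k ->
  bounded_measurable (cell T : set (@measurable_spacetime R d)) (fun p => k p.1).
Proof.
move=> [mk [B kB]]; split; last by exists B => p [pT _]; exact: kB.
apply: (measurable_comp _ _ mk) => //; first by move=> _ [p [/= pT _] <-].
by apply: measurable_funTS; exact: measurable_fst.
Qed.

Section strong_solution_fields.
Context {R : realType} (d : nat) (T : R) (T_gt0 : 0 < T) (P U : R -> R).
Context (PU : pressure_law d P U) (h : R -> R) (hw : weight T h).
Local Notation N := (d + 1)%N.
Local Notation ST := (R * 'rV[R]_d)%type.
Local Notation X := (@measurable_spacetime R d).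
Local Notation D := (cell T : set X).
Variables (v0 : 'rV[R]_d -> 'rV[R]_N) (v : ST -> 'rV[R]_N).
Hypothesis strong : strong_solution P U T h v0 v.

Let weak := strong_weak strong.

Lemma slab_density_gt0 p : slab T p -> 0 < density (v p).
Proof. by case: p => t x /slabP tT; exact: (strong_density strong). Qed.

Lemma bounded_measurable_state i : bounded_measurable D (fun p => v p 0 i).
Proof. by apply: slab_bounded_measurable_mx; case: (weak_continuous weak). Qed.

Let bounded_measurable_density_comp (k : R -> R) :
  (forall y, 0 < y -> {for y, continuous k}) ->
  bounded_measurable D (fun p => k (density (v p))).
Proof.
move=> ck; under eq_fun do rewrite densityE.
apply: (@slab_bounded_measurable_comp _ _ _ (fun p => v p 0 (rshift d ord0)) k _ _ ck).
  by apply: within_entry; case: (weak_continuous weak).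
by move=> p sp; rewrite -densityE; exact: slab_density_gt0.
Qed.

Let continuous_derive1n k y : 0 < y -> {for y, continuous (derive1n k U)}.
Proof.
move=> y0; apply: differentiable_continuous; apply/derivable1_diffP.
exact: (@energy_smooth _ _ _ _ PU k y y0).
Qed.

Lemma bounded_measurable_Dflux l i j :
  bounded_measurable D (fun p => Dflux P U l (v p) i j).
Proof.
(* This stands for [derive1 P]: its continuity on positive densities is immediate from the
   smoothness of [U]. *)
pose P' y := derive1n 2 U y * y.
pose diag' i y := if @fintype.split d 1 i is inl _ then P' y
  else 2 * derive1n 1 U y - d%:R * P' y - 1.
have cst c : bounded_measurable D (fun=> c) by exact: bounded_measurable_cst.
have bP' : bounded_measurable D (fun p => P' (density (v p))).
  apply: bounded_measurable_density_comp => y y0; apply: cvgM; last exact: cvg_id.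
  exact: continuous_derive1n.
have bd : bounded_measurable D (fun p => diag' i (density (v p))).
  rewrite /diag'; case: fintype.split => _ //.
  apply: bounded_measurableB => //; apply: bounded_measurableB.
    apply: bounded_measurableM => //; apply: bounded_measurable_density_comp => y y0.
    exact: continuous_derive1n.
  exact: bounded_measurableM.
have binv : bounded_measurable D (fun p => (density (v p))^-1).
  apply: (bounded_measurable_density_comp (k := @GRing.inv R)) => y y0.
  by apply: cvgV; [rewrite gt_eqF | exact: cvg_id].
have bv := bounded_measurable_state.
apply: (@eq_bounded_measurable _ _ _ _ (fun p =>
  (density (v p))^-1 * ((l == i)%:R * v p 0 j + (l == j)%:R * v p 0 i)
  - (l == rshift d ord0)%:R * ((density (v p))^-1 * (density (v p))^-1 * (v p 0 i * v p 0 j))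
  + (i == j)%:R * ((l == rshift d ord0)%:R * diag' i (density (v p))))).
  move=> p /cell_slab/slab_density_gt0 r0; rewrite DfluxE// /flux_deriv expr2.
  congr (_ + _ * (_ * _)); have [DP DPE] := is_derive_pressure PU r0.
  by rewrite /flux_diag' /diag' /P' (derive1E P) DPE.
apply: bounded_measurableD; last first.
  by apply: bounded_measurableM; [exact: cst | apply: bounded_measurableM; [exact: cst|]].
have b1 i1 j1 : bounded_measurable D (fun p => (l == i1)%:R * v p 0 j1).
  by apply: bounded_measurableM; [exact: cst | exact: bv].
apply: bounded_measurableB.
  by apply: bounded_measurableM; [exact: binv | apply: bounded_measurableD; exact: b1].
apply: bounded_measurableM; first exact: cst.
by apply: bounded_measurableM; apply: bounded_measurableM; [exact: binv|exact: binv|exact: bv|exact: bv].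
Qed.

Lemma bounded_measurable_entropy_grad l :
  bounded_measurable D (fun p => entropy_grad P U (v p) 0 l).
Proof.
apply: (@eq_bounded_measurable _ _ _ _ (fun p => 2^-1 * \sum_i Dflux P U l (v p) i i)).
  by move=> p /cell_slab/slab_density_gt0 r0; rewrite entropy_gradE.
apply: bounded_measurableM; first exact: bounded_measurable_cst.
by apply: bounded_measurable_sum => i; exact: bounded_measurable_Dflux.
Qed.

Lemma bounded_measurable_flux i j :
  bounded_measurable D (fun p => flux P U (v p) i j).
Proof.
have [_ cF] := weak_F_continuous weak.
exact: (slab_bounded_measurable_mx i j cF).
Qed.

Lemma bounded_measurable_entropy :
  bounded_measurable D (fun p => entropy P U (v p)).
Proof.
apply: bounded_measurableM; first exact: bounded_measurable_cst.
by apply: bounded_measurable_sum => i; exact: bounded_measurable_flux.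
Qed.

End strong_solution_fields.

(** * The excess matrix and the weighted energy inequality *)

Section relative_entropy.
Context {R : realType} (d : nat) (T : R) (T_gt0 : 0 < T) (P U : R -> R).
Context (PU : pressure_law d P U) (h : R -> R) (hw : weight T h).
Local Notation N := (d + 1)%N.
Local Notation ST := (R * 'rV[R]_d)%type.
Local Notation X := (@measurable_spacetime R d).
Local Notation D := (cell T : set X).
Local Notation H := (weight_tail T h).
Variables (v0 : 'rV[R]_d -> 'rV[R]_N) (v w : ST -> 'rV[R]_N) (M : ST -> 'M[R]_N).
Hypothesis v0c : torus_continuous v0.
Hypothesis strong : strong_solution P U T h v0 v.
Hypothesis sub : subsolution P U T v0 w M.
Local Notation IL := (Rintegral (leb_spacetime d)).
Local Notation vs p l := (entropy_grad P U (v p) 0 l).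

(** The matrix [G] of the overview. The next two definitions are the spatial densities of [W] and of
    [Kt - K]. *)
Definition excess p i j : R := M p i j - flux P U (v p) i j
  - \sum_l (w p 0 l - v p 0 l) * Dflux P U l (v p) i j.

Definition work p : R := \sum_l (w p 0 l - v p 0 l) * vs p l.

Definition energy_gap p : R := 2^-1 * \tr (M p) - entropy P U (v p).

Let mD : measurable D. Proof. exact: measurable_cell. Qed.
Let sIL : signed_integral D IL. Proof. exact: signed_leb. Qed.
Let bv i : bounded_measurable D (fun p => v p 0 i).
Proof. exact: (bounded_measurable_state strong). Qed.
Let bw i : bounded_measurable D (fun p => w p 0 i).
Proof. by apply: slab_bounded_measurable_mx; case: (Defs.sub_continuous sub). Qed.
Let bM i j : bounded_measurable D (fun p => M p i j).
Proof. by apply: slab_bounded_measurable_mx; case: (Defs.sub_M_continuous sub). Qed.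
Let bF i j : bounded_measurable D (fun p => flux P U (v p) i j).
Proof. exact: (bounded_measurable_flux strong). Qed.
Let bDF l i j : bounded_measurable D (fun p => Dflux P U l (v p) i j).
Proof. exact: (bounded_measurable_Dflux PU strong). Qed.
Let bvs l : bounded_measurable D (fun p => vs p l).
Proof. exact: (bounded_measurable_entropy_grad PU strong). Qed.
Let bwv l : bounded_measurable D (fun p => w p 0 l - v p 0 l).
Proof. exact: bounded_measurableB. Qed.
Let bH : bounded_measurable D (fun p => H p.1).
Proof. exact/bounded_measurable_time/bounded_measurable_weight_tail. Qed.

Let bh : bounded_measurable D (fun p => h p.1).
Proof. exact/bounded_measurable_time/bounded_measurable_weight. Qed.

Let bv0 i : bounded_measurable D (fun p => v0 p.2 0 i).
Proof.
apply: bounded_measurable_continuous => p.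
apply: (@continuous_comp _ _ _ (fun p => v0 p.2) (fun u : 'rV[R]_N => u 0 i)).
  apply: (@continuous_comp _ _ _ snd v0); first exact: cvg_snd.
  by have [_ c] := v0c; exact: c.
exact: coord_continuous.
Qed.

Lemma bounded_measurable_excess i j : bounded_measurable D (fun p => excess p i j).
Proof.
apply: bounded_measurableB; first exact: bounded_measurableB.
by apply: bounded_measurable_sum => l; exact: bounded_measurableM.
Qed.

Lemma bounded_measurable_work : bounded_measurable D work.
Proof. by apply: bounded_measurable_sum => l; exact: bounded_measurableM. Qed.

Lemma bounded_measurable_energy_gap : bounded_measurable D energy_gap.
Proof.
apply: bounded_measurableB; last exact: (bounded_measurable_entropy strong).
apply: bounded_measurableM; first exact: bounded_measurable_cst.
exact: bounded_measurable_sum.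
Qed.

Lemma excess_psd p : slab T p -> psd (\matrix_(i, j) excess p i j).
Proof.
move=> sp; apply: flux_excess_psd => //.
- exact: (slab_density_gt0 strong).
- by case: p sp => t x /slabP tT; exact: (Defs.sub_dom sub).
- by case: p sp => t x /slabP tT; exact: (Defs.sub_le sub).
Qed.

(** The entropy is half the trace of the flux, so the traces of the [Dflux] are twice the components
    of [entropy_grad], and the first-order term contributes [2 * work]. *)
Lemma tr_excess p : slab T p ->
  \sum_i excess p i i = 2 * (energy_gap p - work p).
Proof.
move=> sp; have r0 := slab_density_gt0 strong sp.
rewrite /excess !sumrB exchange_big /= /energy_gap /entropy /mxtrace /work.
have -> : \sum_l \sum_i (w p 0 l - v p 0 l) * Dflux P U l (v p) i i =
    2 * \sum_l (w p 0 l - v p 0 l) * vs p l.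
  rewrite mulr_sumr; apply: eq_bigr => l _.
  by rewrite -mulr_sumr (entropy_gradE PU)//; field.
by field.
Qed.

Lemma work_le p : slab T p -> work p <= energy_gap p.
Proof.
move=> sp; rewrite -subr_ge0 -(pmulr_rge0 _ (ltr0Sn R 1)) -tr_excess//.
apply: sumr_ge0 => i _.
have /psdP[_ /(_ (fun j => (j == i)%:R))] := excess_psd sp.
congr (0 <= _).
rewrite (bigD1 i)//= [X in _ + X]big1 ?addr0; last first.
  by move=> j /negbTE ji; rewrite big1// => k _; rewrite ji mul0r mulr0.
rewrite (bigD1 i)//= big1 ?addr0 ?eqxx ?mxE ?mulr1// => j /negbTE ->.
by rewrite mulr0 mulr0.
Qed.


Section decaying_weight.
Variable lam : R.
Local Notation decay p := (expR (- lam * p.1)).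

Let bdecay : bounded_measurable D (fun p => decay p).
Proof. exact: bounded_measurable_decay. Qed.

Let bcst (c : R) : bounded_measurable D (fun=> c).
Proof. exact: bounded_measurable_cst. Qed.

(* [E] and [B] are the measures [d_t(decay H v^#)] and [decay H L^* v^#]. *)
Lemma lin_constraint_decay (mu : 'I_N -> @radon R d) (nu : 'I_N -> 'I_N -> @radon R d)
    (E : 'I_N -> @radon R d) (B : 'I_N -> 'I_N -> @radon R d) :
  let Hv := fun p : ST => H p.1 *: entropy_grad P U (v p) in
  (forall phi : ST -> 'rV[R]_N, smooth_on_slab phi -> (forall x, phi (0, x) = 0) ->
    pairing_v T phi mu = - pairing_L T (Dt phi) Hv) ->
  (forall Phi : ST -> 'M[R]_N, smooth_on_slab Phi -> (forall p, (Phi p)^T = Phi p) ->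
    pairing_m T Phi nu = pairing_L T (div_op Phi) Hv) ->
  (forall l g, bounded_measurable D g -> charge_integral (E l) D g =
    IL D (fun p => g p * (- lam * decay p * (H p.1 * vs p l))) +
    charge_integral (mu l) D (fun p => g p * decay p)) ->
  (forall i j g, bounded_measurable D g -> charge_integral (B i j) D g =
    charge_integral (nu i j) D (fun p => g p * decay p)) ->
  lin_constraint T E B.
Proof.
move=> Hv muE nuE EE BE Psi sPsi symPsi Psi0.
pose Phi p := decay p *: Psi p.
have sPhi : smooth_on_slab Phi by exact: smooth_on_slab_decay.
have symPhi p : (Phi p)^T = Phi p by rewrite linearZ /= symPsi.
have sDt : smooth_on_slab (Dt Phi) by exact: smooth_on_slab_derive.
have symDt p : (Dt Phi p)^T = Dt Phi p by apply: derive_sym => //; case: sPhi.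
have sdiv : smooth_on_slab (div_op Phi) by exact: smooth_on_slab_div_op.
have Phi0 x : div_op Phi (0, x) = 0.
  by apply: div_op_initial => y; rewrite /Phi Psi0 scaler0.
have b_entry m n (F : ST -> 'M[R]_(m, n)) i j : smooth_on_slab F ->
    bounded_measurable D (fun p => F p i j) by exact: bounded_measurable_smooth.
have -> : pairing_m T (Dt Psi) B = pairing_m T (Dt Phi) nu + lam * pairing_m T Phi nu.
  rewrite /pairing_m mulr_sumr -big_split; apply: eq_bigr => i _ /=.
  rewrite mulr_sumr -big_split; apply: eq_bigr => j _ /=.
  have snu := signed_charge_integral D (nu i j).
  rewrite BE; last by apply: b_entry; exact: smooth_on_slab_derive.
  rewrite -(signed_integralZ _ snu)//; last exact: b_entry.
  rewrite -(signed_integralD snu)//; first last.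
  - by apply: bounded_measurableM; [exact: bcst | exact: b_entry].
  - exact: b_entry.
  congr charge_integral; apply/funext => p.
  by rewrite /Dt derive_decay// !mxE /= mulr1; ring.
have -> : pairing_v T (div_op Psi) E =
    - lam * pairing_L T (div_op Phi) Hv + pairing_v T (div_op Phi) mu.
  rewrite /pairing_v /pairing_L.
  rewrite (signed_integral_sum (index_enum 'I_N)
    (f := fun i (p : X) => div_op Phi p 0 i * Hv p 0 i) sIL mD)//; last first.
    move=> i; apply: bounded_measurableM; first exact: b_entry.
    by under eq_fun do rewrite mxE; exact: bounded_measurableM.
  rewrite mulr_sumr -big_split; apply: eq_bigr => l _ /=.
  rewrite EE; last by apply: b_entry; exact: smooth_on_slab_div_op.
  congr (_ + _).
    rewrite -(signed_integralZ _ sIL)//; last first.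
      apply: bounded_measurableM; first exact: b_entry.
      by under eq_fun do rewrite mxE; exact: bounded_measurableM.
    congr Rintegral; apply/funext => p.
    by rewrite /Phi div_op_decay// !mxE; ring.
  congr charge_integral; apply/funext => p.
  by rewrite /Phi div_op_decay// !mxE; ring.
(* The two [lam] terms are now the same [pairing_L] with opposite signs; the other two cancel once
   [Dt] and [div_op] are exchanged. *)
rewrite (nuE _ sDt symDt) (nuE _ sPhi symPhi) (muE _ sdiv Phi0).
have -> : div_op (Dt Phi) = Dt (div_op Phi).
  by apply/funext => p; rewrite Dt_div_op.
by ring.
Qed.

(** The [mu] terms [b l] occur identically in [eq1] and [eq2]. Subtraction removes them and leaves
    [nu] paired with the excess on one side, Lebesgue integrals on the other. *)
Lemma weighted_excessE (mu : 'I_N -> @radon R d) (nu : 'I_N -> 'I_N -> @radon R d) :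
  let Hv := fun p : ST => H p.1 *: entropy_grad P U (v p) in
  sym_valued T nu ->
  (forall phi : ST -> 'rV[R]_N, smooth_on_slab phi -> (forall x, phi (0, x) = 0) ->
    pairing_v T phi mu = - pairing_L T (Dt phi) Hv) ->
  (forall Phi : ST -> 'M[R]_N, smooth_on_slab Phi -> (forall p, (Phi p)^T = Phi p) ->
    pairing_m T Phi nu = pairing_L T (div_op Phi) Hv) ->
  (forall l A, measurable A -> A `<=` D ->
    IL A (fun p => h p.1 * vs p l) + fine (mu l A)
    + \sum_i \sum_j charge_integral (nu i j) A (fun p => Dflux P U l (v p) i j) = 0) ->
  \sum_i \sum_j charge_integral (nu i j) D (fun p => excess p i j * decay p) =
  IL D (fun p => (lam * H p.1 + h p.1) * decay p * work p).
Proof.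
move=> Hv symnu muE nuE bal.
have snu i j := signed_charge_integral D (nu i j).
have smu l := signed_charge_integral D (mu l).
have bE l : bounded_measurable D (fun p => - lam * decay p * (H p.1 * vs p l)).
  by apply: bounded_measurableM; [exact: bounded_measurableM | exact: bounded_measurableM].
have /choice[E EE] l := charge_density2 mD sIL (smu l) (bE l) bdecay.
have /choice[B' BB'] (ij : 'I_N * 'I_N) := charge_density mD (snu ij.1 ij.2) bdecay.
pose B i j := B' (i, j).
have BE i j g : bounded_measurable D g -> charge_integral (B i j) D g =
    charge_integral (nu i j) D (fun p => g p * decay p) by exact: (BB' (i, j)).2.
have symB : sym_valued T B.
  move=> A i j mA AD; rewrite /B !(BB' _).1//=; congr EFin.
  apply: (eq_charge_integral mA) => [C mC CA|]; last exact: bounded_measurableS bdecay.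
  by apply: symnu => //; exact: subset_trans AD.
have lc : lin_constraint T E B by exact: (lin_constraint_decay muE nuE EE BE).
have weq := weak_eq (strong_weak strong) symB lc.
have seq := sub_eq sub symB lc.
pose F l p := w p 0 l - v p 0 l.
pose a l := IL D (fun p => F l p * (- lam * decay p * (H p.1 * vs p l))).
pose b l := charge_integral (mu l) D (fun p => F l p * decay p).
pose m i j := charge_integral (nu i j) D (fun p => (M p i j - flux P U (v p) i j) * decay p).
pose k l i j := charge_integral (nu i j) D (fun p => F l p * decay p * Dflux P U l (v p) i j).
pose e l := IL D (fun p => F l p * decay p * (h p.1 * vs p l)).
have bFl l : bounded_measurable D (fun p => F l p) by exact: bwv.
have bFd l : bounded_measurable D (fun p => F l p * decay p).
  by apply: bounded_measurableM; [exact: bFl | exact: bdecay].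
(* The difference of the two weak formulations; the common initial datum disappears. *)
have eq1 : \sum_l (a l + b l) + \sum_i \sum_j m i j = 0.
  have E1 : pairing_v T (fun p => w p - v0 p.2) E =
      \sum_l (a l + b l) + pairing_v T (fun p => v p - v0 p.2) E.
    rewrite /pairing_v -big_split; apply: eq_bigr => l _ /=.
    have sE := signed_charge_integral D (E l).
    rewrite /a /b -EE; last exact: bwv.
    rewrite -(signed_integralD sE)//.
      by congr charge_integral; apply/funext => p; rewrite !mxE /F; ring.
    by under eq_fun do rewrite !mxE; exact: bounded_measurableB.
  have E2 : pairing_m T M B = \sum_i \sum_j m i j + pairing_m T (flux P U \o v) B.
    rewrite /pairing_m -big_split; apply: eq_bigr => i _ /=.
    rewrite -big_split; apply: eq_bigr => j _ /=.
    have sB := signed_charge_integral D (B i j).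
    rewrite /m -BE; last exact: bounded_measurableB.
    rewrite -(signed_integralD sB)//; last exact: bounded_measurableB.
    by congr charge_integral; apply/funext => p; rewrite /= subrK.
  by move: seq weq; rewrite E1 E2; lra.
(* Condition (iv) tested with [(w - v)_l * decay]. *)
have eq2 l : e l + b l + \sum_i \sum_j k l i j = 0.
  have bhv : bounded_measurable D (fun p => h p.1 * vs p l) by exact: bounded_measurableM.
  have := @signed_integral_balance _ _ _ _ mD ('I_N * 'I_N)%type IL
    (charge_integral (mu l)) (fun ij => charge_integral (nu ij.1 ij.2))
    (fun p => h p.1 * vs p l) (cst 1) (fun ij p => Dflux P U l (v p) ij.1 ij.2)
    (fun p => F l p * decay p) sIL (smu l) (fun ij => snu ij.1 ij.2) bhv (bcst 1)
    (fun ij => bDF l ij.1 ij.2) (bFd l).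
  rewrite -(pair_bigA _ (fun i j => charge_integral (nu i j) D
    (fun p => F l p * decay p * Dflux P U l (v p) i j))) /=.
  have -> : charge_integral (mu l) D (fun p => F l p * decay p * cst 1 p) = b l.
    by congr charge_integral; apply/funext => p; rewrite /= mulr1.
  apply=> A mA AD; rewrite charge_integral_cst1//.
  by rewrite -(pair_bigA _ (fun i j => charge_integral (nu i j) A
    (fun p => Dflux P U l (v p) i j))) /= bal.
have eq3 i j : charge_integral (nu i j) D (fun p => excess p i j * decay p) =
    m i j - \sum_l k l i j.
  rewrite /m /k -(signed_integral_sum _ (snu i j) mD)//; last first.
    by move=> l; exact: bounded_measurableM.
  have bS : bounded_measurable D (fun p => \sum_l F l p * decay p * Dflux P U l (v p) i j).
    by apply: bounded_measurable_sum => l; exact: bounded_measurableM.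
  rewrite -(signed_integralN (snu i j) mD _ bS)// -(signed_integralD (snu i j))//.
  - congr charge_integral; apply/funext => p; rewrite /excess mulrBl mulr_suml.
    by congr (_ - _); apply: eq_bigr => l _; rewrite /F; ring.
  - by apply: bounded_measurableM => //; exact: bounded_measurableB.
  - exact: bounded_measurableN.
have eq4 : IL D (fun p => (lam * H p.1 + h p.1) * decay p * work p) = \sum_l (e l - a l).
  have be l : bounded_measurable D (fun p => F l p * decay p * (h p.1 * vs p l)).
    by apply: bounded_measurableM => //; exact: bounded_measurableM.
  have ba l : bounded_measurable D (fun p => F l p * (- lam * decay p * (H p.1 * vs p l))).
    by apply: bounded_measurableM; [exact: bFl | exact: bE].
  transitivity (\sum_l IL D (fun p => F l p * decay p * (h p.1 * vs p l)
      - F l p * (- lam * decay p * (H p.1 * vs p l)))).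
    rewrite -(signed_integral_sum _ sIL mD)//; last by move=> l; exact: bounded_measurableB.
    congr Rintegral; apply/funext => p; rewrite /work mulr_sumr.
    by apply: eq_bigr => l _; rewrite /F; ring.
  apply: eq_bigr => l _; rewrite /e /a -(signed_integralN sIL mD _ (ba l))//.
  by rewrite -(signed_integralD sIL)//; exact: bounded_measurableN.
rewrite eq4; under eq_bigr do under eq_bigr do rewrite eq3.
have -> : \sum_i \sum_j (m i j - \sum_l k l i j) =
    \sum_i \sum_j m i j - \sum_l \sum_i \sum_j k l i j.
  have -> : \sum_l \sum_i \sum_j k l i j = \sum_i \sum_j \sum_l k l i j.
    by rewrite exchange_big; apply: eq_bigr => i _; rewrite exchange_big.
  by rewrite -sumrB; apply: eq_bigr => i _; rewrite -sumrB.
have eq2' : \sum_l \sum_i \sum_j k l i j = - \sum_l (e l + b l).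
  rewrite -sumrN; apply: eq_bigr => l _; apply/eqP.
  by rewrite -addr_eq0 addrC eq2.
by move: eq1; rewrite eq2' sumrB !big_split /=; lra.
Qed.

End decaying_weight.

Lemma energy_gap_inequality : exists2 c, 0 < c & forall lam,
  0 <= IL D (fun p => expR (- lam * p.1) *
    ((lam * H p.1 + h p.1 - 2 * c) * work p + 2 * c * energy_gap p)).
Proof.
have [mu [nu [symnu muE nuE [c c0 psdc] bal]]] := strong_measures strong.
(* The constant of the sign condition may be 0 and a positive one is wanted; enlarging it is
   harmless since [energy_gap - work >= 0]. *)
exists (c + 1) => [|lam]; first by rewrite ltr_wpDl.
have ex := weighted_excessE lam symnu muE nuE bal.
pose decay (p : X) := expR (- lam * p.1).
have bdecay : bounded_measurable D decay by exact: bounded_measurable_decay.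
pose g (ij : 'I_N * 'I_N) (p : X) := excess p ij.1 ij.2 * decay p.
have bg ij : bounded_measurable D (g ij).
  by apply: bounded_measurableM => //; exact: bounded_measurable_excess.
(* Index [true] carries [nu], index [false] carries [c] times the identity times Lebesgue measure.
   With the common test matrix [excess * decay], positivity on a set becomes a Frobenius product of
   two positive semidefinite matrices. *)
pose I (o : bool * ('I_N * 'I_N)) :=
  if o.1 then charge_integral (nu o.2.1 o.2.2) else IL.
pose f (o : bool * ('I_N * 'I_N)) : X -> R :=
  if o.1 then cst 1 else cst (c * (o.2.1 == o.2.2)%:R).
have sI o : signed_integral D (I o).
  by case: o => -[] ij //; exact: signed_charge_integral.
have bf o : bounded_measurable D (f o).
  by case: o => -[] ij; exact: bounded_measurable_cst.
have sumJ (F : bool * ('I_N * 'I_N) -> R) : \sum_o F o =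
    \sum_i \sum_j F (true, (i, j)) + \sum_i \sum_j F (false, (i, j)).
  rewrite (pair_bigA _ (fun i j => F (true, (i, j)))).
  rewrite (pair_bigA _ (fun i j => F (false, (i, j)))) /=.
  transitivity (\sum_b \sum_ij F (b, ij)); first by rewrite pair_bigA; apply: eq_bigr => -[].
  rewrite (bigD1 true)//= (big_pred1 false) => [|[]//].
  by congr (_ + _); apply: eq_bigr => -[].
have := signed_integral_pairing_ge0 mD sI bf (fun o => bg o.2).
rewrite sumJ /I /f /g /=.
have -> : \sum_i \sum_j charge_integral (nu i j) D
      (fun p => excess p i j * decay p * cst 1 p) =
    IL D (fun p => (lam * H p.1 + h p.1) * decay p * work p).
  rewrite -ex; apply: eq_bigr => i _; apply: eq_bigr => j _.
  by congr charge_integral; apply/funext => p; rewrite /= mulr1.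
have bw' : bounded_measurable D work by exact: bounded_measurable_work.
have bgap : bounded_measurable D energy_gap by exact: bounded_measurable_energy_gap.
have bex i j : bounded_measurable D (fun p => excess p i j * decay p * (c * (i == j)%:R)).
  by apply: bounded_measurableM; [exact: (bg (i, j)) | exact: bounded_measurable_cst].
have bgw : bounded_measurable D (fun p => energy_gap p - work p) by exact: bounded_measurableB.
have bcst (a : R) : bounded_measurable D (fun=> a) by exact: bounded_measurable_cst.
have bd2 : bounded_measurable D (fun p => 2 * c * decay p * (energy_gap p - work p)).
  by apply: bounded_measurableM => //; exact: bounded_measurableM.
have -> : \sum_i \sum_j IL D (fun p => excess p i j * decay p * cst (c * (i == j)%:R) p) =
    IL D (fun p => 2 * c * decay p * (energy_gap p - work p)).
  transitivity (\sum_i IL D (fun p => \sum_j excess p i j * decay p * (c * (i == j)%:R))).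
    by apply: eq_bigr => i _; rewrite -(signed_integral_sum _ sIL mD).
  rewrite -(signed_integral_sum _ sIL mD)//; last by move=> i; exact: bounded_measurable_sum.
  apply/esym/(eq_signed_integral sIL mD _ bd2) => // p /cell_slab sp.
  transitivity (c * decay p * \sum_i excess p i i).
    by rewrite tr_excess//; ring.
  rewrite mulr_sumr; apply: eq_bigr => i _.
  rewrite (bigD1 i)//= eqxx mulr1 big1 ?addr0; first by ring.
  by move=> j; rewrite eq_sym => /negbTE ->; rewrite !mulr0.
move=> pairing; apply: le_trans (pairing _) _; last first.
  have bHh : bounded_measurable D (fun p => (lam * H p.1 + h p.1) * decay p * work p).
    apply: bounded_measurableM => //; apply: bounded_measurableM => //.
    by apply: bounded_measurableD => //; exact: bounded_measurableM.
  rewrite -(signed_integralD sIL)// -subr_ge0.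
  have bl : bounded_measurable D (fun p => (lam * H p.1 + h p.1) * decay p * work p +
      2 * c * decay p * (energy_gap p - work p)) by exact: bounded_measurableD.
  rewrite -(signed_integralN sIL mD _ bl)//.
  rewrite -(signed_integralD sIL mD)//; last exact: bounded_measurableN.
    apply: Rintegral_ge0 => p /cell_slab sp.
    have -> : forall x y z t : R, x * ((y - 2 * (c + 1)) * z + 2 * (c + 1) * t) +
      - (y * x * z + 2 * c * x * (t - z)) = 2 * (x * (t - z)) by move=> *; ring.
    by rewrite mulr_ge0// mulr_ge0 ?expR_ge0// subr_ge0 work_le.
  apply: bounded_measurableM => //; apply: bounded_measurableD; last first.
    by apply: bounded_measurableM => //.
  apply: bounded_measurableM => //; apply: bounded_measurableB => //.
  by apply: bounded_measurableD => //; exact: bounded_measurableM.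
move=> p A /cell_slab sp mA AD; rewrite sumJ /=.
have -> : \sum_i \sum_j excess p i j * decay p * charge_integral (nu i j) A (cst 1) +
    \sum_i \sum_j excess p i j * decay p * IL A (cst (c * (i == j)%:R)) =
    decay p * \sum_i \sum_j (\matrix_(i, j) excess p i j) i j *
      (\matrix_(i, j) fine (nu i j A) + (c * fine (leb_spacetime d A))%:M) i j.
  rewrite mulr_sumr -big_split; apply: eq_bigr => i _ /=.
  rewrite mulr_sumr -big_split; apply: eq_bigr => j _ /=.
  rewrite !mxE charge_integral_cst1// Rintegral_cst//.
  by rewrite -[_ *+ _]mulr_natr; ring.
rewrite mulr_ge0 ?expR_ge0//; apply: psd_frobenius_ge0; first exact: excess_psd.
exact: psdc.
Qed.

End relative_entropy.

(** * Localization in time *)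

(** A zero integral would force [f = 0] almost everywhere, which a set of positive measure
    forbids. *)
Lemma Rintegral_gt0 dX (X : measurableType dX) (R : realType)
    (m : {measure set X -> \bar R}) (D : set X) (f : X -> R) :
  measurable D -> (0 < m D < +oo)%E -> bounded_measurable D f ->
  (forall x, D x -> 0 < f x) -> 0 < \int[m]_(x in D) f x.
Proof.
move=> mD /andP[mD0 mDoo] bf f0.
have fint := bounded_measurable_integrable_lty mD mDoo bf.
rewrite lt_neqAle eq_sym Rintegral_ge0 ?andbT; last by move=> x /f0/ltW.
apply/eqP => int0.
have : (\int[m]_(x in D) `|(EFin \o f) x|)%E = 0%E.
  rewrite -[RHS]/(0%:E) -int0 /Rintegral fineK; last exact: integrable_fin_num.
  by apply: eq_integral => x /[!inE] /f0 fx; rewrite /= gtr0_norm.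
move/(ae_eq_integral_abs m mD (measurable_int _ fint)) => [A [mA A0 DA]].
have : (m D <= m A)%E.
  apply: le_measure; rewrite ?inE// => x Dx; apply: DA => /= /(_ Dx) [fx].
  by have := f0 x Dx; rewrite fx ltxx.
by rewrite A0 leNgt mD0.
Qed.

Section cell_fubini.
Context {R : realType} (d : nat) (T : R).
Local Notation X := (@measurable_spacetime R d).
Local Notation D := (cell T : set X).

Lemma bounded_measurable_slice (f : X -> R) t : bounded_measurable D f ->
  0 <= t <= T -> bounded_measurable (@unit_cell R d) (fun x => f (t, x)).
Proof.
move=> [mf [B fB]] tT; split.
  apply: (measurable_comp _ _ mf); first exact: measurable_cell.
    by move=> _ [x xQ <-]; split => //=; rewrite in_itv.
  by apply: measurable_funTS; exact: measurable_pair1.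
by exists B => x xQ; apply: fB; split => //=; rewrite in_itv.
Qed.

Lemma torus_integralD (f g : 'rV[R]_d -> R) :
  bounded_measurable (@unit_cell R d) f -> bounded_measurable (@unit_cell R d) g ->
  torus_integral (fun x => f x + g x) = torus_integral f + torus_integral g.
Proof.
have mQ := @measurable_unit_cell R d; have Qoo := @lebesgue_unit_cell_lty R d.
by move=> bf bg; apply: RintegralD => //; exact: bounded_measurable_integrable_lty.
Qed.

Lemma torus_integralZ (k : R) (f : 'rV[R]_d -> R) :
  bounded_measurable (@unit_cell R d) f ->
  torus_integral (fun x => k * f x) = k * torus_integral f.
Proof.
have mQ := @measurable_unit_cell R d; have Qoo := @lebesgue_unit_cell_lty R d.
by move=> bf; apply: RintegralZl => //; exact: bounded_measurable_integrable_lty.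
Qed.

Section fubini.
Variable f : X -> R.
Hypothesis bf : bounded_measurable D f.
Let F t := torus_integral (fun x => f (t, x)).

Let intf : (leb_spacetime d).-integrable setT ((EFin \o f) \_ D).
Proof.
rewrite -integrable_mkcond; last exact: measurable_cell.
apply: bounded_measurable_integrable_lty => //; first exact: measurable_cell.
exact: leb_cell_lty.
Qed.

Let inner t : (\int[lebesgue_rV d]_x ((EFin \o f) \_ D) (t, x))%E =
  ((EFin \o F) \_ `[0, T]) t.
Proof.
rewrite [RHS]patchE; case: ifPn => [|tT].
  rewrite inE /= in_itv /= => tT.
  rewrite /F /torus_integral /Rintegral fineK; last first.
    apply: integrable_fin_num; first exact: measurable_unit_cell.
    apply: bounded_measurable_integrable_lty.
    - exact: measurable_unit_cell.
    - exact: lebesgue_unit_cell_lty.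
    - exact: bounded_measurable_slice.
  rewrite [RHS]integral_mkcond; apply: eq_integral => x _.
  rewrite !patchE; have [xQ|xQ] := boolP (x \in @unit_cell R d).
    rewrite mem_set//; split; [by rewrite /= in_itv | exact: set_mem].
  by rewrite memNset// => -[_ /mem_set]; exact/negP.
under eq_integral => x _.
  rewrite patchE memNset; last first.
    by move=> [/= tT' _]; move/negP: tT; apply; rewrite inE.
  over.
by rewrite integral0.
Qed.

Lemma bounded_measurable_torus_integral :
  bounded_measurable (`[0, T]%classic : set (measurableTypeR R)) F.
Proof.
have [_ [B fB]] := bf; split; last first.
  exists (B * fine (lebesgue_rV d (@unit_cell R d))) => t /=.
  rewrite in_itv /= => tT; apply: Rintegral_bounded_lty.
  - exact: measurable_unit_cell.
  - exact: lebesgue_unit_cell_lty.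
  - exact: bounded_measurable_slice.
  - by move=> x xQ; apply: fB; split => //=; rewrite in_itv.
have mF := measurable_fubini_F intf.
apply: (@eq_measurable_fun _ _ _ _ _ (fine \o (EFin \o F) \_ `[0, T])).
  by move=> t tT; rewrite /= patchE tT.
apply: measurableT_comp; first exact: fine_measurable.
apply: measurable_funTS.
rewrite (_ : _ \_ _ = fun t => \int[lebesgue_rV d]_x ((EFin \o f) \_ D) (t, x))%E //.
by apply/funext => t; rewrite -inner.
Qed.

Lemma Rintegral_cell : \int[leb_spacetime d]_(p in D) f p =
  \int[lebesgue_measure]_(t in `[0, T]) F t.
Proof.
congr fine.
rewrite integral_mkcond [RHS]integral_mkcond.
transitivity (\int[lebesgue_measure \x lebesgue_rV d]_p ((EFin \o f) \_ D) p)%E => //.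
rewrite -(integral12_prod_meas1 intf).
by apply: eq_integral => t _; exact: inner.
Qed.

End fubini.
End cell_fubini.

Section early_gap.
Context {R : realType}.
Local Notation mu := (@lebesgue_measure R).
Local Notation I T := (`[0, T]%classic : set (measurableTypeR R)).

Lemma expR_dominates (K del L : R) : 0 < K -> 0 < del -> 0 <= L ->
  exists2 lam, L <= lam & (1 + lam) * expR (- lam * del) < K.
Proof.
(* Since [expR x >= (x / 2)^2] for [x >= 0], it suffices that [1 + lam < K del^2 lam^2 / 4]. As
   [1 + lam <= 2 lam], the condition [8 < K del^2 lam] is enough. *)
move=> K0 d0 L0; pose lam := 1 + L + 8 / (K * del ^+ 2).
have q0 : 0 < 8 / (K * del ^+ 2) by rewrite divr_gt0// mulr_gt0// exprn_gt0.
have lam1 : 1 <= lam by rewrite /lam -addrA lerDl addr_ge0// ltW.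
have lam0 : 0 < lam by rewrite (lt_le_trans ltr01).
exists lam; first by rewrite /lam; lra.
rewrite mulNr expRN ltr_pdivrMr ?expR_gt0//.
have half : lam * del / 2 <= expR (lam * del / 2).
  by apply: le_trans (expR_ge1Dx _); rewrite lerDr.
have sq : (lam * del / 2) ^+ 2 <= expR (lam * del).
  rewrite [X in expR X](_ : _ = lam * del / 2 + lam * del / 2); last by field.
  rewrite expRD -expr2 lerXn2r// ?nnegrE ?expR_ge0//.
  by rewrite divr_ge0// mulr_ge0 ?(ltW lam0)// ltW.
apply: lt_le_trans (ler_wpM2l (ltW K0) sq).
have : 8 < K * del ^+ 2 * lam.
  rewrite mulrC -ltr_pdivrMr; last by rewrite mulr_gt0// exprn_gt0.
  by rewrite /lam ltrDr ltr_wpDr.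
move=> big8; have big : 8 * lam < K * del ^+ 2 * lam * lam by rewrite ltr_pM2r.
have -> : K * (lam * del / 2) ^+ 2 = K * del ^+ 2 * lam * lam / 4 by field.
by lra.
Qed.

(* The [2 c E] term beats the rest of the integral for large [lam]: it is
   negative before time [s1], whereas the possibly positive contributions only
   occur after [s2 > s1], where [expR (- lam * t)] is exponentially smaller. *)
Lemma no_early_gap (T a c t0 t1 : R) (W E H h : R -> R) :
  0 < a -> 0 < c -> 0 <= t0 -> t0 < t1 -> t1 <= T ->
  bounded_measurable (I T) W -> bounded_measurable (I T) E ->
  bounded_measurable (I T) H -> bounded_measurable (I T) h ->
  (forall t, 0 <= t <= T -> W t <= E t) ->
  (forall t, 0 <= t <= T -> a * (T - t) <= H t) ->
  (forall t, 0 <= t <= T -> 0 <= h t) ->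
  (forall lam, 0 <= \int[mu]_(t in `[0, T])
    (expR (- lam * t) * ((lam * H t + h t - 2 * c) * W t + 2 * c * E t))) ->
  (forall t, 0 < t <= t0 -> E t <= 0) -> (forall t, t0 < t < t1 -> E t < 0) ->
  False.
Proof.
move=> a0 c0 t00 t01 t1T bW bE bH bh WE Ha h0 ineq Et0 Et1.
have T0 : 0 < T by lra.
have mT : measurable (I T) by exact: measurable_itv.
have muT := @lebesgue_measure_itv R `[0, T].
rewrite /= lte_fin T0 sube0 in muT.
have Too : (mu `[0%R, T]%classic < +oo)%E by rewrite [X in (X < _)%E]muT ltry.
have [CW CW0 WC] := bounded_measurableP bW.
have [CE CE0 EC] := bounded_measurableP bE.
have [CH CH0 HC] := bounded_measurableP bH.
have [Ch Ch0 hC] := bounded_measurableP bh.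
(* For every [lam >= 0], [C * (1 + lam)] bounds the factor of [expR (- lam * t)] in the
   integrand. *)
pose C := (CH + Ch + 2 * c) * CW + 2 * c * CE.
have C0 : 0 < C by rewrite addr_gt0// !mulr_gt0// !addr_gt0// mulr_gt0.
(* Staying below [t1], [s2] is less than [T], so [H] is at least [a * (T - s2) > 0] up to time
   [s2]. *)
pose s1 := t0 + (t1 - t0) / 3; pose s2 := t0 + 2 * (t1 - t0) / 3.
have t0s1 : t0 < s1 by rewrite /s1; lra.
have s12 : s1 < s2 by rewrite /s1 /s2; lra.
have s2t1 : s2 < t1 by rewrite /s2; lra.
have JT : `]t0, s1[%classic `<=` `]0, T]%classic.
  by move=> t; rewrite /= !in_itv /= => /andP[? ?]; lra.
have OT : `]0, T]%classic `<=` `[0, T]%classic by exact: subset_itv_oc_cc.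
have JT' := subset_trans JT OT.
pose m := \int[mu]_(t in `]t0, s1[) - E t.
have m0 : 0 < m.
  apply: Rintegral_gt0 => //.
  - have J := @lebesgue_measure_itv R `]t0, s1[; rewrite /= lte_fin t0s1 in J.
    by rewrite [X in (_ < X < _)%E]J -EFinB lte_fin subr_gt0 t0s1 ltry.
  - exact/bounded_measurableN/(bounded_measurableS mT JT' bE).
  - move=> t; rewrite /= in_itv /= => /andP[? ?].
    by rewrite oppr_gt0; apply: Et1; lra.
have Ts2 : 0 < a * (T - s2) by rewrite mulr_gt0//; lra.
have q0 : 0 <= 2 * c / (a * (T - s2)).
  by apply: divr_ge0; [rewrite mulr_ge0// ltW | exact: ltW].
(* The first bound makes the coefficient of [W] nonnegative up to [s2]. The second makes the late
   loss [C (1 + lam) T expR (- lam s2)] smaller than the early gain [2 c m expR (- lam s1)]. *)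
have [lam lamL small] : exists2 lam, 1 + 2 * c / (a * (T - s2)) <= lam &
    (1 + lam) * expR (- lam * (s2 - s1)) < 2 * c * m / (C * T).
  apply: expR_dominates; rewrite ?subr_gt0//.
    by rewrite divr_gt0 ?mulr_gt0.
  by rewrite addr_ge0.
have lam0 : 0 <= lam by lra.
have lamc t : 0 <= t <= s2 -> 0 <= lam * H t + h t - 2 * c.
  move=> /andP[t_ge ts2]; have tT : 0 <= t <= T by apply/andP; split; lra.
  have : 2 * c <= lam * H t.
    apply: (@le_trans _ _ (lam * (a * (T - s2)))).
      by rewrite -ler_pdivrMr//; lra.
    rewrite ler_wpM2l// (le_trans _ (Ha t tT))// ler_wpM2l ?(ltW a0)//; lra.
  by have := h0 t tT; lra.
pose f t := expR (- lam * t) * ((lam * H t + h t - 2 * c) * W t + 2 * c * E t).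
(* A majorant of [f] on []0, T]]. On []t0, s1[] the negative [E] keeps at least the weight at [s1];
   at other times before [s2] a nonpositive quantity is dropped; the constant covers the times after
   [s2]. *)
pose g t := 2 * c * expR (- lam * s1) * (E \_ `]t0, s1[%classic) t +
  C * (1 + lam) * expR (- lam * s2).
have bcst (b : R) : bounded_measurable (I T) (fun=> b : R).
  exact: bounded_measurable_cst.
have bdec : bounded_measurable (I T) (fun t => expR (- lam * t)).
  split.
    apply: measurable_funTS.
    exact: (measurableT_comp (@measurable_expR R) (@mulrl_measurable R setT (- lam))).
  exists 1 => t; rewrite /= in_itv /= => /andP[t_ge _].
  by rewrite ger0_norm ?expR_ge0// -expR0 ler_expR mulNr oppr_le0 mulr_ge0.
have bf : bounded_measurable (I T) f.
  apply: bounded_measurableM => //; apply: bounded_measurableD; last exact: bounded_measurableM.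
  apply: bounded_measurableM => //; apply: bounded_measurableB => //.
  by apply: bounded_measurableD => //; exact: bounded_measurableM.
have bEJ : bounded_measurable (I T) (E \_ `]t0, s1[%classic).
  apply: (@eq_bounded_measurable _ _ _ _ (fun t => E t * \1_(`]t0, s1[%classic) t)).
    by move=> t _; rewrite patchE indicE; case: ifP; rewrite ?mulr1 ?mulr0.
  apply: bounded_measurableM => //; split; first exact: measurable_indic.
  by exists 1 => t _; rewrite indicE ger0_norm// lern1 leq_b1.
have bg : bounded_measurable (I T) g.
  by apply: bounded_measurableD => //; exact: bounded_measurableM.
have mO : measurable (`]0, T]%classic : set (measurableTypeR R)) by exact: measurable_itv.
have intO k : bounded_measurable (I T) k ->
    mu.-integrable `]0, T]%classic (EFin \o k).
  move=> bk; apply: (integrableS mT mO OT).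
  exact: bounded_measurable_integrable_lty.
(* Time 0 is left out because no sign of [E] is assumed there; it is a null set. *)
have fg : \int[mu]_(t in `]0, T]) f t <= \int[mu]_(t in `]0, T]) g t.
  apply: le_Rintegral; [exact: mO | exact: intO | exact: intO |].
  move=> t tO; have tT := OT _ tO; have Wt := WC _ tT; have Et := EC _ tT.
  have Htt := HC _ tT; have htt := hC _ tT.
  move: tO tT; rewrite /= !in_itv /= => /andP[t_gt tT] tT'.
  have WEt := WE _ tT'; rewrite /f /g patchE.
  have K0 : 0 <= C * (1 + lam) * expR (- lam * s2).
    by rewrite !mulr_ge0 ?expR_ge0 ?(ltW C0)// addr_ge0.
  have [ts2|s2t] := ltP t s2.
    have E_le0 : E t <= 0.
      by have [?|?] := leP t t0; [apply: Et0; lra | apply/ltW/Et1; lra].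
    have coef : 0 <= lam * H t + h t - 2 * c by apply: lamc; lra.
    have step : f t <= expR (- lam * t) * (2 * c * E t).
      rewrite /f ler_wpM2l ?expR_ge0// gerDr mulr_ge0_le0//; lra.
    apply: (le_trans step); case: ifPn => [|_].
      rewrite inE /= in_itv /= => /andP[_ ts1].
      apply: (@le_trans _ _ (2 * c * expR (- lam * s1) * E t)); last by rewrite lerDl.
      rewrite [leLHS](_ : _ = 2 * c * E t * expR (- lam * t)); last by ring.
      rewrite [leRHS](_ : _ = 2 * c * E t * expR (- lam * s1)); last by ring.
      rewrite ler_wnM2l//; first by rewrite mulr_ge0_le0// mulr_ge0// ltW.
      by rewrite ler_expR !mulNr lerN2 ler_wpM2l// ltW.
    rewrite mulr0 add0r (le_trans _ K0)// mulr_ge0_le0 ?expR_ge0//.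
    by rewrite mulr_ge0_le0// mulr_ge0// ltW.
  case: ifPn => [|_]; first by rewrite inE /= in_itv /= => /andP[_ ?]; lra.
  rewrite mulr0 add0r mulrC.
  apply: (@le_trans _ _ (C * (1 + lam) * expR (- lam * t))); last first.
    rewrite ler_wpM2l//; first by rewrite mulr_ge0 ?(ltW C0)// addr_ge0.
    by rewrite ler_expR !mulNr lerN2 ler_wpM2l.
  rewrite ler_wpM2r ?expR_ge0//; apply: le_trans (ler_norm _) _.
  rewrite (le_trans (ler_normD _ _))// (normrM _ (W t)) (normrM (2 * c)).
  have c2 : `|2 * c| = 2 * c by rewrite ger0_norm// mulr_ge0// ltW.
  rewrite c2.
  have coefC : `|lam * H t + h t - 2 * c| <= (CH + Ch + 2 * c) * (1 + lam).
    rewrite (le_trans (ler_normB _ _))// c2.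
    rewrite (le_trans (lerD (ler_normD _ _) (lexx _)))// normrM (ger0_norm lam0).
    have : lam * `|H t| <= lam * CH by rewrite ler_wpM2l.
    have : 0 <= Ch * lam by rewrite mulr_ge0// ltW.
    have : 0 <= c * lam by rewrite mulr_ge0// ltW.
    by lra.
  have p1 : `|lam * H t + h t - 2 * c| * `|W t| <= (CH + Ch + 2 * c) * (1 + lam) * CW.
    by apply: ler_pM.
  have p2 : 2 * c * `|E t| <= 2 * c * CE by rewrite ler_wpM2l// mulr_ge0// ltW.
  have p3 : 0 <= 2 * c * CE * lam by rewrite !mulr_ge0// ltW.
  by rewrite /C; lra.
have := ineq lam; rewrite -/f -(Rintegral_itv_obnd_cbnd (intO _ bf)) => f_ge0.
have gE : \int[mu]_(t in `]0, T]) g t =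
    - (2 * c * expR (- lam * s1) * m) + C * (1 + lam) * expR (- lam * s2) * T.
  rewrite RintegralD//; last 2 first.
  - by apply: intO; exact: bounded_measurableM.
  - exact: intO.
  rewrite RintegralZl//; last exact: intO.
  rewrite Rintegral_cst// -Rintegral_mkcondr setIidr//.
  have O := @lebesgue_measure_itv R `]0, T]; rewrite /= lte_fin T0 sube0 in O.
  rewrite [X in fine X]O /= -mulrN; congr (_ * _ + _).
  rewrite /m -[RHS]mulN1r -RintegralZl//.
    by apply: eq_Rintegral => t _; rewrite mulN1r opprK.
  have mJ : measurable (`]t0, s1[%classic : set (measurableTypeR R)) by exact: measurable_itv.
  exact: (integrableS mO mJ JT (intO _ (bounded_measurableN bE))).
have CT0 : 0 < C * T by rewrite mulr_gt0.
move: fg; rewrite gE => /(le_trans f_ge0).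
rewrite addrC subr_ge0 leNgt => /negP; apply.
rewrite ltr_pdivlMr// in small.
have -> : expR (- lam * s2) = expR (- lam * (s2 - s1)) * expR (- lam * s1).
  by rewrite -expRD; congr expR; ring.
rewrite [ltLHS](_ : _ = (1 + lam) * expR (- lam * (s2 - s1)) * (C * T) * expR (- lam * s1)); last by ring.
rewrite [ltRHS](_ : _ = 2 * c * m * expR (- lam * s1)); last by ring.
by rewrite ltr_pM2r ?expR_gt0.
Qed.

End early_gap.

Theorem corollary5p4 (R : realType) (d : nat) (d_gt0 : (0 < d)%N)
  (T : R) (T_gt0 : 0 < T)
  (P U : R -> R) (PU : pressure_law d P U)
  (h : R -> R) (h_weight : weight T h)
  (q0 : 'rV[R]_d -> 'rV[R]_d) (rho0 : 'rV[R]_d -> R)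
  (v0_continuous : torus_continuous (fun x => state (q0 x) (rho0 x)))
  (rho0_gt0 : forall x, 0 < rho0 x)
  (q : R * 'rV[R]_d -> 'rV[R]_d) (rho : R * 'rV[R]_d -> R)
  (qrho_strong : strong_solution P U T h
    (fun x => state (q0 x) (rho0 x)) (fun p => state (q p) (rho p)))
  (qt : R * 'rV[R]_d -> 'rV[R]_d) (rhot : R * 'rV[R]_d -> R)
  (M : R * 'rV[R]_d -> 'M[R]_(d + 1))
  (qrhot_sub : subsolution P U T
    (fun x => state (q0 x) (rho0 x)) (fun p => state (qt p) (rhot p)) M) :
  let K := fun t : R => torus_integral (fun x : 'rV[R]_d =>
    (\sum_(i < d) q (t, x) 0 i ^+ 2) / (2 * rho (t, x)) + U (rho (t, x))) in
  let Kt := fun t : R =>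
    2^-1 * torus_integral (fun x : 'rV[R]_d => \tr (M (t, x))) in
  (forall t0 t1 : R, 0 <= t0 -> t0 < t1 -> t1 <= T ->
    ~ ((forall t, 0 <= t <= t0 -> Kt t <= K t) /\
       (forall t, t0 < t < t1 -> Kt t < K t))) /\
  ~ (exists eps : R, [/\ 0 < eps, eps <= T &
       forall t, 0 < t < eps -> Kt t < K t]).
Proof.
move=> K Kt.
set v0 := fun x => state (q0 x) (rho0 x).
set v := fun p => state (q p) (rho p).
set w := fun p => state (qt p) (rhot p).
(* The weak inequality is asked at positive times only: for [t0 = 0] it is void, so the second claim
   is an instance too. *)
have main t0 t1 : 0 <= t0 -> t0 < t1 -> t1 <= T ->
    (forall t, 0 < t <= t0 -> Kt t <= K t) ->
    (forall t, t0 < t < t1 -> Kt t < K t) -> False.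
  move=> t00 t01 t1T le_K lt_K.
  have [c c0 ineq] := energy_gap_inequality T_gt0 PU h_weight v0_continuous
    qrho_strong qrhot_sub.
  have [a [b [a0 hab]]] := weight_bounds h_weight.
  pose e := energy_gap P U v M.
  pose wk := work P U v w.
  have be : bounded_measurable (cell T : set (@measurable_spacetime R d)) e.
    exact: (bounded_measurable_energy_gap qrho_strong qrhot_sub).
  have bwk : bounded_measurable (cell T : set (@measurable_spacetime R d)) wk.
    exact: (bounded_measurable_work PU qrho_strong qrhot_sub).
  have EK t : 0 <= t <= T -> torus_integral (fun x => e (t, x)) = Kt t - K t.
    move=> tT.
    have bS : bounded_measurable (@unit_cell R d) (fun x => \tr (M (t, x))).
      apply: (@bounded_measurable_slice R d T (fun p => \tr (M p)) t) => //.
      apply: bounded_measurable_sum => i.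
      by apply: slab_bounded_measurable_mx; case: (sub_M_continuous qrhot_sub).
    have bK : bounded_measurable (@unit_cell R d) (fun x => entropy P U (v (t, x))).
      apply: (@bounded_measurable_slice R d T (fun p => entropy P U (v p)) t) => //.
      exact: (bounded_measurable_entropy qrho_strong).
    have -> : K t = torus_integral (fun x => entropy P U (v (t, x))).
      apply: eq_Rintegral => x _; rewrite entropy_state//.
      have := strong_density qrho_strong x tT.
      by rewrite /density /state row_mxKr mxE eqxx.
    rewrite /Kt -torus_integralZ// -mulN1r -torus_integralZ// -torus_integralD//.
    - by apply: eq_Rintegral => x _; rewrite mulN1r.
    - exact/bounded_measurableM/bS/bounded_measurable_cst.
    - exact/bounded_measurableM/bK/bounded_measurable_cst.
  apply: (@no_early_gap R T a c t0 t1 (fun t => torus_integral (fun x => wk (t, x)))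
    (fun t => torus_integral (fun x => e (t, x))) (weight_tail T h) h) => //.
  - exact: bounded_measurable_torus_integral.
  - exact: bounded_measurable_torus_integral.
  - exact: bounded_measurable_weight_tail.
  - exact: bounded_measurable_weight.
  - move=> t tT.
    have mQ := @measurable_unit_cell R d; have Qoo := @lebesgue_unit_cell_lty R d.
    have slice f : bounded_measurable (cell T : set (@measurable_spacetime R d)) f ->
        (lebesgue_rV d).-integrable (@unit_cell R d) (EFin \o fun x => f (t, x)).
      move=> bf; apply: bounded_measurable_integrable_lty => //.
      exact: bounded_measurable_slice bf tT.
    apply: le_Rintegral => //; [exact: slice | exact: slice | move=> x _].
    apply: (work_le PU qrho_strong qrhot_sub).
    by split => //=; rewrite in_itv.
  - apply: weight_tail_ge => // [|t tT]; first exact: ltW.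
    by have /andP[] := hab t tT.
  - by move=> t tT; exact: (weight_ge0 h_weight).
  (* All the weights depend on time only, so Fubini turns the space-time inequality into one for the
     spatial integrals of [wk] and [e]. *)
  - move=> lam; have := ineq lam; rewrite Rintegral_cell.
      congr (0 <= _); apply: eq_Rintegral => t; rewrite inE /= in_itv /= => tT.
      have bw := bounded_measurable_slice bwk tT.
      have bE := bounded_measurable_slice be tT.
      have bcst z : bounded_measurable (@unit_cell R d) (fun=> z : R).
        exact: bounded_measurable_cst.
      rewrite torus_integralZ; last first.
        by apply: bounded_measurableD; apply: bounded_measurableM.
      rewrite torus_integralD; last 2 first.
      + exact: bounded_measurableM.
      + exact: bounded_measurableM.
      by rewrite !torus_integralZ.
    have bdecay := @bounded_measurable_decay R d T lam.
    have bcst z : bounded_measurable (cell T : set (@measurable_spacetime R d)) (fun=> z : R).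
      exact: bounded_measurable_cst.
    apply: bounded_measurableM => //; apply: bounded_measurableD; apply: bounded_measurableM => //.
    apply: bounded_measurableB => //; apply: bounded_measurableD; last first.
      exact/bounded_measurable_time/bounded_measurable_weight.
    apply: bounded_measurableM => //.
    exact/bounded_measurable_time/bounded_measurable_weight_tail.
  - by move=> t /andP[t_gt tt0]; rewrite EK ?subr_le0 ?le_K ?t_gt//; apply/andP; split; lra.
  - by move=> t /andP[t_gt tt1]; rewrite EK ?subr_lt0 ?lt_K ?t_gt//; apply/andP; split; lra.
split=> [t0 t1 t00 t01 t1T [le_K lt_K]|[eps [eps0 epsT lt_K]]].
  by apply: (main t0 t1) => // t /andP[t_gt tt0]; apply: le_K; rewrite tt0 ltW.
by apply: (main 0 eps) => // t /andP[t_gt t_le]; have := lt_le_trans t_gt t_le; rewrite ltxx.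
Qed.
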